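(* Let $x,x_1,x_2$ be roots of unity and $p_1,p_2,q\ge1$ integers with $(p_1,x_1)\ne(1,1)$, $(p_2,x_2)\neq(1,1)$ and $(q,xx_1x_2)\ne(1,1)$. Then \begin{align*} &x\,T_{p_1,p_2;q}\big(x_1,x_2;(xx_1x_2)^{-1}\big)+(-1)^{p_1+p_2+q}\,T_{p_1,p_2;q}\big(x_1^{-1},x_2^{-1};xx_1x_2\big)\\ &=x\,T_{p_1;p_2+q}\big(x_1;(xx_1)^{-1}\big)+x\,T_{p_2;p_1+q}\big(x_2;(xx_2)^{-1}\big)\\ &\quad+x\,\mathrm{ti}_{p_1}(x_1)T_{p_2;q}\big(x_2;(xx_1x_2)^{-1}\big)+x\,\mathrm{ti}_{p_2}(x_2)T_{p_1;q}\big(x_1;(xx_1x_2)^{-1}\big)\\ &\quad-(-1)^{p_2+q}x_1^{-1}\mathrm{ti}_{p_1}(x_1)T_{p_2;q}\big(x_2^{-1};xx_1x_2\big)-(-1)^{p_1+q}x_2^{-1}\mathrm{ti}_{p_2}(x_2)T_{p_1;q}\big(x_1^{-1};xx_1x_2\big)\\ &\quad+(-1)^{p_1+p_2+q}\mathrm{ti}_{p_1+p_2+q}(x)-x\,\mathrm{ti}_{p_1}(x_1)\mathrm{ti}_{p_2+q}\big((xx_1)^{-1}\big)-x\,\mathrm{ti}_{p_2}(x_2)\mathrm{ti}_{p_1+q}\big((xx_2)^{-1}\big)\\ &\quad-x\,\mathrm{ti}_{p_1}(x_1)\mathrm{ti}_{p_2}(x_2)\mathrm{ti}_q\big((xx_1x_2)^{-1}\big)-(-1)^q(x_1x_2)^{-1}\mathrm{ti}_{p_1}(x_1)\mathrm{ti}_{p_2}(x_2)\mathrm{ti}_q(xx_1x_2)\\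 &\quad-\sum_{\substack{m+k=p_1+q-1\\ m,k\ge0}}(-1)^k\binom{k+p_2-1}{p_2-1}\mathrm{Li}_{k+p_2}(x_2)\Big((-1)^m\mathrm{ti}_{m+1}(x)-x\,\mathrm{ti}_{m+1}\big(x^{-1}\big)\Big)\\ &\quad-\sum_{\substack{m+k=p_2+q-1\\ m,k\ge0}}(-1)^k\binom{k+p_1-1}{p_1-1}\mathrm{Li}_{k+p_1}(x_1)\Big((-1)^m\mathrm{ti}_{m+1}(x)-x\,\mathrm{ti}_{m+1}\big(x^{-1}\big)\Big)\\ &\quad-(-1)^q\sum_{m=0}^{p_1+p_2-1}\binom{p_1+p_2+q-m-2}{q-1}\Big((-1)^m\mathrm{ti}_{m+1}(x)-x\,\mathrm{ti}_{m+1}\big(x^{-1}\big)\Big)\mathrm{Li}_{p_1+p_2+q-m-1}(xx_1x_2)\\ &\quad-\sum_{\substack{m+k_1+k_2=q-1\\ m,k_1,k_2\ge0}}(-1)^{k_1+k_2}\binom{k_1+p_1-1}{p_1-1}\binom{k_2+p_2-1}{p_2-1}\mathrm{Li}_{k_1+p_1}(x_1)\mathrm{Li}_{k_2+p_2}(x_2)\Big((-1)^m\mathrm{ti}_{m+1}(x)-x\,\mathrm{ti}_{m+1}\big(x^{-1}\big)\Big)\\ &\quad-(-1)^q\sum_{\substack{m+k\le p_2-1\\ m,k\ge0}}\binom{k+p_1-1}{p_1-1}\binom{p_2+q-m-k-2}{q-1}\Big((-1)^m\mathrm{ti}_{m+1}(x)-x\,\mathrm{ti}_{m+1}\big(x^{-1}\big)\Big)\\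 &\qquad\times\Big((-1)^k\mathrm{Li}_{k+p_1}(x_1)\mathrm{Li}_{p_2+q-m-k-1}(xx_1x_2)+(-1)^{p_1}S_{k+p_1;p_2+q-m-k-1}\big(x_1^{-1};xx_1x_2\big)\Big)\\ &\quad-(-1)^q\sum_{\substack{m+k\le p_1-1\\ m,k\ge0}}\binom{k+p_2-1}{p_2-1}\binom{p_1+q-m-k-2}{q-1}\Big((-1)^m\mathrm{ti}_{m+1}(x)-x\,\mathrm{ti}_{m+1}\big(x^{-1}\big)\Big)\\ &\qquad\times\Big((-1)^k\mathrm{Li}_{k+p_2}(x_2)\mathrm{Li}_{p_1+q-m-k-1}(xx_1x_2)+(-1)^{p_2}S_{k+p_2;p_1+q-m-k-1}\big(x_2^{-1};xx_1x_2\big)\Big). \end{align*}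
   Context: For a positive integer $p$, $n\ge0$ and a root of unity $z$: $t_n(p;z):=\sum_{k=1}^n\frac{z^k}{(k-1/2)^p}$ and $\zeta_n(p;z):=\sum_{k=1}^n\frac{z^k}{k^p}$; for $(p,z)\ne(1,1)$, $\mathrm{ti}_p(z):=\sum_{n=1}^\infty\frac{z^n}{(n-1/2)^p}$ and $\mathrm{Li}_p(z):=\sum_{n=1}^\infty\frac{z^n}{n^p}$. For positive integers $p,p',q$ and roots of unity $z,z',w$ with $(q,w)\ne(1,1)$: $T_{p;q}(z;w):=\sum_{n=1}^\infty\frac{t_n(p;z)}{(n-1/2)^q}w^n$, $\;T_{p,p';q}(z,z';w):=\sum_{n=1}^\infty\frac{t_n(p;z)t_n(p';z')}{(n-1/2)^q}w^n$, and $S_{p;q}(z;w):=\sum_{n=1}^\infty\frac{\zeta_n(p;z)}{n^q}w^n$. Convention when $x=1$: the ($m=0$) factor $\mathrm{ti}_1(x)-x\,\mathrm{ti}_1(x^{-1})$ is read as $0$, and each term containing it is $0$. *)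

(* Defs.v *)
From mathcomp Require Import all_boot all_order all_algebra complex.
From mathcomp Require Import boolp classical_sets reals topology normedtype.
From mathcomp Require Import sequences.

Set Implicit Arguments.
Unset Strict Implicit.
Unset Printing Implicit Defensive.

Import Order.TTheory GRing.Theory Num.Theory.
Import numFieldNormedType.Exports.
Local Open Scope classical_set_scope.
Local Open Scope ring_scope.

(* The ambient field is an arbitrary K : numFieldType because it is at this
   generality that the library equips a field with the topology of its norm;
   the case of interest is K := R[i] for R : realType, the complex numbers.
   Infinite sums are limits of the ordered partial sums, as required for the
   conditionally convergent series occurring here when the exponent is 1. *)

(* 0.-unity_root z holds for every z, hence the condition 0 < n. *)
Definition is_root_of_unity (K : numFieldType) (z : K) : Prop :=
  exists2 n : nat, (0 < n)%N & n.-unity_root z.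

Definition tn (K : numFieldType) (n p : nat) (z : K) : K :=
  \sum_(1 <= k < n.+1) z ^+ k / (k%:R - 2^-1) ^+ p.

Definition zetan (K : numFieldType) (n p : nat) (z : K) : K :=
  \sum_(1 <= k < n.+1) z ^+ k / k%:R ^+ p.

Definition ti (K : numFieldType) (p : nat) (z : K) : K :=
  limn (fun N => \sum_(1 <= n < N) z ^+ n / (n%:R - 2^-1) ^+ p).

Definition Li (K : numFieldType) (p : nat) (z : K) : K :=
  limn (fun N => \sum_(1 <= n < N) z ^+ n / n%:R ^+ p).

(* T_{p;q}(z;w) *)
Definition Tlin (K : numFieldType) (p q : nat) (z w : K) : K :=
  limn (fun N => \sum_(1 <= n < N) tn n p z / (n%:R - 2^-1) ^+ q * w ^+ n).

(* T_{p,p';q}(z,z';w) *)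
Definition Tquad (K : numFieldType) (p p' q : nat) (z z' w : K) : K :=
  limn (fun N =>
    \sum_(1 <= n < N) tn n p z * tn n p' z' / (n%:R - 2^-1) ^+ q * w ^+ n).

(* S_{p;q}(z;w) *)
Definition Slin (K : numFieldType) (p q : nat) (z w : K) : K :=
  limn (fun N => \sum_(1 <= n < N) zetan n p z / n%:R ^+ q * w ^+ n).

(* (-1)^m ti_{m+1}(x) - x ti_{m+1}(x^-1); for m = 0 and x = 1 both series
   diverge, and the factor is 0 by convention. *)
Definition ti_factor (K : numFieldType) (m : nat) (x : K) : K :=
  if (m == 0%N) && (x == 1) then 0
  else (-1) ^+ m * ti m.+1 x - x * ti m.+1 x^-1.

(* Main.v *)
Require Import Defs.
From mathcomp Require Import all_boot all_order all_algebra complex.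
From mathcomp Require Import boolp classical_sets reals topology normedtype.
From mathcomp Require Import sequences.
From mathcomp Require Import ring zify.

(** Write Phi_p(s; z) for the Lerch function, the sum over k >= 0 of
    z^k / (s + k)^p, and let
      G(s) = Phi_p1(s; x1) * Phi_p2(s; x2) / s^q.
    The identity is obtained by evaluating the sum of x^(1 - n) * G(n - 1/2)
    over all integers n in two ways.

    Over the half-integers.  For n >= 1 the value Phi_p(n - 1/2; z) is
    z^(-n) times the tail ti_p(z) - t_(n-1)(p; z), and at 1/2 - n the finitely
    many terms with s + k < 0 add a multiple of t_n(p; z^-1) to a multiple of
    ti_p(z).  Expanding the two products turns the sum into the series T and
    ti of the statement ([kernel_limit]).

    Over the poles.  G is the sum of its polar parts at 0, -1, -2, ...
    The sum over n of x^(1 - n) / (n - 1/2 + j)^(m + 1), taken symmetrically,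
    is - x^j * ti_factor m x ([bilateral_sum_pole]); for m = 0 and x = 1 it
    vanishes because the summand is odd, which is the convention attached to
    ti_factor.  At -j the function Phi_p is z^j / (s + j)^p
    plus a regular part, whose Taylor coefficients are values of Li (from the
    terms k > j) and of zeta_j at z^-1 (from the terms k < j).  Summing the
    polar parts of the product over j gives the series Li and S
    ([residue_limit]).

    To justify the exchange of summations without complex analysis, both Lerch
    functions are cut at k < N.  The kernel is then a rational function, its
    partial fraction expansion is a finite identity ([partial_fraction3]), and
    its bilateral sum is computed term by term ([bilateral_sum_kernel_cvg]).
    It remains to let N tend to infinity on both sides.  Series with exponent 1
    converge only conditionally, but summation by parts bounds all tails
    beyond a by C / a ([dirichlet_test], [tame_series_bounded]).  Replacing a
    truncated function by its limit at the index n therefore costs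
    O(1 / (n * (N + 1 - n))), and these errors add up to O(log N / N)
    ([harmonic_convolution_cvg0]). *)

Set Implicit Arguments.
Unset Strict Implicit.
Unset Printing Implicit Defensive.

Import Order.TTheory GRing.Theory Num.Theory.
Import numFieldNormedType.Exports.
Local Open Scope ring_scope.

(** * Taylor coefficients and partial fractions *)

Local Notation inv_powers u := (fun m : nat => (u ^+ m.+1)^-1).

Section PartialFractions.
Variable K : fieldType.
Implicit Types (a b u v w : K) (c k : nat -> K).

(** Coefficient of u^t in (a + u)^(-p); the truncated p + t - 1 is harmless
    because the binomial coefficient is right also for p = 0. *)
Definition taylor_coef (p : nat) a (t : nat) : K :=
  (-1) ^+ t * 'C(p + t - 1, t)%:R / a ^+ (p + t).

(** Coefficient of u^t in (a + u)^(-p) * (b + u)^(-q). *)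
Definition taylor_coef2 (p q : nat) a b (t : nat) : K :=
  \sum_(i < t.+1) taylor_coef p a i * taylor_coef q b (t - i).

Lemma taylor_coef0l a t : taylor_coef 0 a t = (t == 0%N)%:R.
Proof.
rewrite /taylor_coef add0n; case: t => [|t];
  first by rewrite bin0 expr0 mul1r divr1.
by rewrite bin_small ?subn1 // mulr0 mul0r.
Qed.

Lemma taylor_coef_rec0 p a : a != 0 -> a * taylor_coef p.+1 a 0 = taylor_coef p a 0.
Proof.
move=> a0; rewrite /taylor_coef !addn0 !bin0 exprS; field.
by rewrite expf_neq0 a0.
Qed.

(** Comparison of coefficients in (a + u) * (a + u)^(-(p + 1)) = (a + u)^(-p). *)
Lemma taylor_coef_recS p a t : a != 0 ->
  a * taylor_coef p.+1 a t.+1 + taylor_coef p.+1 a t = taylor_coef p a t.+1.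
Proof.
move=> a0; rewrite /taylor_coef.
have -> : (p.+1 + t.+1 - 1 = (p + t).+1)%N by lia.
have -> : (p.+1 + t - 1 = p + t)%N by lia.
have -> : (p + t.+1 - 1 = p + t)%N by lia.
rewrite binS natrD !addSn !addnS !exprS exprD; field.
by rewrite !expf_neq0 // a0.
Qed.

Lemma taylor_coef2C p q a b t : taylor_coef2 p q a b t = taylor_coef2 q p b a t.
Proof.
rewrite /taylor_coef2 (reindex_inj rev_ord_inj) /=; apply: eq_bigr => i _.
by rewrite subSS mulrC subKn // -ltnS.
Qed.

Lemma taylor_coef2_0l q a b t : taylor_coef2 0 q a b t = taylor_coef q b t.
Proof.
rewrite /taylor_coef2 big_ord_recl big1 ?addr0 => [|i _]; last first.
  by rewrite taylor_coef0l mul0r.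
by rewrite taylor_coef0l mul1r subn0.
Qed.

Lemma taylor_coef2_0r q a b t : taylor_coef2 q 0 b a t = taylor_coef q b t.
Proof. by rewrite taylor_coef2C taylor_coef2_0l. Qed.

Lemma taylor_coef2_rec0 p q a b : a != 0 ->
  a * taylor_coef2 p.+1 q a b 0 = taylor_coef2 p q a b 0.
Proof.
by move=> a0; rewrite /taylor_coef2 !big_ord1 mulrA taylor_coef_rec0.
Qed.

Lemma taylor_coef2_recS p q a b t : a != 0 ->
  a * taylor_coef2 p.+1 q a b t.+1 + taylor_coef2 p.+1 q a b t
    = taylor_coef2 p q a b t.+1.
Proof.
move=> a0; rewrite /taylor_coef2 [in LHS]big_ord_recl [in RHS]big_ord_recl /=.
rewrite mulrDr mulrA taylor_coef_rec0 // -addrA; congr (_ + _).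
rewrite mulr_sumr -big_split /=; apply: eq_bigr => i _.
by rewrite /bump /= !add1n subSS mulrA -mulrDl taylor_coef_recS.
Qed.

(** Both sides obey the recurrence coming from multiplication by a + u, so the
    Vandermonde convolution needs no binomial identity. *)
Lemma taylor_coef2_diag p q a t : a != 0 ->
  taylor_coef2 p q a a t = taylor_coef (p + q) a t.
Proof.
move=> a0; elim: p t => [|p IHp] t; first by rewrite taylor_coef2_0l.
elim: t => [|t IHt]; apply: (mulfI a0).
  by rewrite taylor_coef2_rec0 // IHp addSn taylor_coef_rec0.
rewrite addSn; apply: (addIr (taylor_coef (p + q).+1 a t)).
by rewrite taylor_coef_recS // -IHp -addSn -IHt taylor_coef2_recS.
Qed.

(** Polar part of order p of a function with Taylor coefficients c after
    multiplication by u^p, where k m stands for u^-(m + 1).  Leaving k arbitrary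
    allows a linear functional to be applied to the polar part by changing k. *)
Definition principal_part (p : nat) c k : K := \sum_(m < p) c (p - 1 - m)%N * k m.

(** If a * c + shift c = c', then multiplying by a = (a + u) - u lowers either the
    order of the Taylor factor or the order of the pole. *)
Lemma principal_part_rec p a c c' k :
  a * c 0%N = c' 0%N -> (forall t, a * c t.+1 + c t = c' t.+1) ->
  a * principal_part p.+1 c k = principal_part p.+1 c' k - principal_part p c k.
Proof.
move=> h0 hS; rewrite /principal_part 2!big_ord_recr /= subn1 /= subnn -h0.
rewrite mulrDr mulrA; apply/eqP; rewrite -subr_eq0 opprB opprD !addrA.
rewrite mulr_sumr; apply/eqP.
transitivity (\sum_(i < p) (a * (c (p - i)%N * k i) - c' (p - i)%N * k i
   + c (p - 1 - i)%N * k i)); last first.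
  apply: big1 => i _.
  have -> : (p - i = (p - 1 - i).+1)%N by have := ltn_ord i; lia.
  by rewrite -hS; ring.
by rewrite big_split sumrB /=; ring.
Qed.

Lemma principal_part_single p c k : (forall t, c t = (t == 0%N)%:R) ->
  principal_part p.+1 c k = k p.
Proof.
move=> hc; rewrite /principal_part big_ord_recr /= big1 => [|i _].
  by rewrite subn1 subnn hc mul1r add0r.
by rewrite hc subn1 /= subn_eq0 leqNgt ltn_ord mul0r.
Qed.

Lemma principal_part0 c k : principal_part 0 c k = 0.
Proof. exact: big_ord0. Qed.

Lemma principal_part2_rec p q r a b k : a != 0 -> b != 0 ->
  (b - a) * principal_part r (taylor_coef2 p.+1 q.+1 a b) k
  = principal_part r (taylor_coef2 p.+1 q a b) k
    - principal_part r (taylor_coef2 p q.+1 a b) k.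
Proof.
move=> a0 b0; rewrite /principal_part mulr_sumr -sumrB; apply: eq_bigr => m _.
rewrite mulrA -mulrBl; congr (_ * _).
case: (r - 1 - m)%N => [|t].
  by rewrite mulrBl taylor_coef2_rec0 // taylor_coef2C taylor_coef2_rec0 //
    taylor_coef2C.
have ha := taylor_coef2_recS p q.+1 b t a0.
have := taylor_coef2_recS q p.+1 a t b0.
rewrite ![taylor_coef2 _ p.+1 _ _ _]taylor_coef2C -ha => <-.
by ring.
Qed.

Lemma eq_principal_part p c c' k : (forall t, c t = c' t) ->
  principal_part p c k = principal_part p c' k.
Proof. by move=> cc'; apply: eq_bigr => m _; rewrite cc'. Qed.

(** Same induction as for three points, which uses this case when an exponent
    is zero. *)
Lemma partial_fraction2 p q u v :
  u != 0 -> v != 0 -> u != v -> (0 < p + q)%N ->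
  (u ^+ p * v ^+ q)^-1 = principal_part p (taylor_coef q (v - u)) (inv_powers u)
                       + principal_part q (taylor_coef p (u - v)) (inv_powers v).
Proof.
move=> u0 v0 uv; have uv0 : u - v != 0 by rewrite subr_eq0.
have vu0 : v - u != 0 by rewrite subr_eq0 eq_sym.
have [n] := ubnP (p + q)%N; elim: n p q => // n IHn [|p] [|q] // hn _.
- by rewrite principal_part0 add0r expr0 mul1r principal_part_single // => t;
    rewrite taylor_coef0l.
- by rewrite principal_part0 addr0 expr0 mulr1 principal_part_single // => t;
    rewrite taylor_coef0l.
apply: (mulfI vu0); rewrite mulrDr.
rewrite (principal_part_rec _ _ (taylor_coef_rec0 q vu0)
  (fun t => taylor_coef_recS q t vu0)).
have eN z : (v - u) * z = - ((u - v) * z) by ring.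
rewrite [X in _ = _ + X]eN.
rewrite (principal_part_rec _ _ (taylor_coef_rec0 p uv0)
  (fun t => taylor_coef_recS p t uv0)).
transitivity ((u ^+ p.+1 * v ^+ q)^-1 - (u ^+ p * v ^+ q.+1)^-1).
  by rewrite !exprS; field; rewrite !expf_neq0 // u0 v0.
by rewrite !IHn; [ring | lia..].
Qed.

Lemma principal_part_recl p q r a b k : a != 0 ->
  a * principal_part p.+1 (taylor_coef2 q.+1 r a b) k
  = principal_part p.+1 (taylor_coef2 q r a b) k
    - principal_part p (taylor_coef2 q.+1 r a b) k.
Proof.
by move=> a0; apply: principal_part_rec => [|t];
  rewrite ?taylor_coef2_rec0 ?taylor_coef2_recS.
Qed.

(** Induction on p + q: the product with v - u of 1 / (u^(p+1) v^(q+1)) is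
    1 / (u^(p+1) v^q) - 1 / (u^p v^(q+1)), and each of the three polar parts
    obeys the same recurrence. *)
Theorem partial_fraction3 p q r u v w :
  u != 0 -> v != 0 -> w != 0 -> u != v -> u != w -> v != w ->
  (0 < p + q + r)%N ->
  (u ^+ p * v ^+ q * w ^+ r)^-1 =
    principal_part p (taylor_coef2 q r (v - u) (w - u)) (inv_powers u)
  + principal_part q (taylor_coef2 p r (u - v) (w - v)) (inv_powers v)
  + principal_part r (taylor_coef2 p q (u - w) (v - w)) (inv_powers w).
Proof.
move=> u0 v0 w0 uv uw vw.
have vu0 : v - u != 0 by rewrite subr_eq0 eq_sym.
have wu0 : w - u != 0 by rewrite subr_eq0 eq_sym.
have uv0 : u - v != 0 by rewrite subr_eq0.
have wv0 : w - v != 0 by rewrite subr_eq0 eq_sym.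
have uw0 : u - w != 0 by rewrite subr_eq0.
have vw0 : v - w != 0 by rewrite subr_eq0.
have [n] := ubnP (p + q)%N; elim: n p q => // n IHn [|p] [|q] hn hr.
- rewrite !principal_part0 !add0r !expr0 !mul1r; clear IHn; case: r hr => // r _.
  by rewrite principal_part_single // => t; rewrite taylor_coef2_0l taylor_coef0l.
- rewrite principal_part0 add0r expr0 mul1r partial_fraction2 //.
  by congr (_ + _); apply: eq_principal_part => t; rewrite taylor_coef2_0l.
- rewrite principal_part0 addr0 expr0 mulr1 partial_fraction2 //.
  by congr (_ + _); apply: eq_principal_part => t;
    rewrite ?taylor_coef2_0l ?taylor_coef2_0r.
- apply: (mulfI vu0); rewrite !mulrDr principal_part_recl //.
  have eN z : (v - u) * principal_part q.+1 z (inv_powers v)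
    = - ((u - v) * principal_part q.+1 z (inv_powers v)) by ring.
  rewrite eN.
  rewrite principal_part_recl //.
  have eD z : (v - u) * z = ((v - w) - (u - w)) * z by ring.
  rewrite [X in _ = _ + X]eD.
  rewrite principal_part2_rec //.
  transitivity ((u ^+ p.+1 * v ^+ q * w ^+ r)^-1
                - (u ^+ p * v ^+ q.+1 * w ^+ r)^-1).
    rewrite ![u ^+ p.+1]exprS ![v ^+ q.+1]exprS.
    by field; rewrite !expf_neq0 // u0 v0.
  by rewrite !IHn //; [ring | clear -hn; lia..].
Qed.

End PartialFractions.

(** * Uniform bounds on tails of oscillating series *)

Section Bounds.
Variable K : numFieldType.
Implicit Types (f g h : nat -> K) (w z C th : K).

(** Telescoping: 1 / n^2 <= 2 / n - 2 / (n + 1). *)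
Lemma sum_inv_sq_le a b : (0 < a <= b)%N ->
  \sum_(a <= n < b) (n%:R ^+ 2)^-1 <= 2 / a%:R :> K.
Proof.
move=> /andP[a0 ab].
suff : \sum_(a <= n < b) (n%:R ^+ 2)^-1 <= 2 / a%:R - 2 / b%:R :> K.
  move=> /le_trans; apply; rewrite gerBl divr_ge0 ?ler0n //.
elim: b ab => [|b IHb]; first by rewrite leqNgt a0.
rewrite leq_eqVlt => /predU1P[<-|ab]; first by rewrite big_geq // subrr.
have b0 : (0 < b)%N by lia.
rewrite big_nat_recr //=; apply: le_trans (lerD (IHb ab) (lexx _)) _.
rewrite -addrA lerD2l -subr_ge0.
have bK : b%:R != 0 :> K by rewrite pnatr_eq0; lia.
have bK' : b.+1%:R != 0 :> K by rewrite pnatr_eq0.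
have -> : - (2 / b.+1%:R) - (- (2 / b%:R) + (b%:R ^+ 2)^-1)
  = (b%:R - 1) / (b%:R ^+ 2 * b.+1%:R) :> K.
  move: bK'; rewrite -natr1 => bK'; field.
  by rewrite bK'  bK.
rewrite divr_ge0 //; last by rewrite mulr_ge0 ?exprn_ge0 ?ler0n.
by rewrite subr_ge0 ler1n.
Qed.

(** Cauchy condition with an explicit rate; the rate, and not only the
    convergence, controls the errors made by truncating the kernel. *)
Definition tail_bounded f := exists2 C : K, 0 <= C &
  forall a b, (0 < a <= b)%N -> `|\sum_(a <= n < b) f n| <= C / a%:R.

Lemma abel_summation w h a b : (a <= b)%N ->
  (1 - w) * \sum_(a <= n < b) h n * w ^+ n =
  h a * w ^+ a - h b * w ^+ b + \sum_(a <= n < b) (h n.+1 - h n) * w ^+ n.+1.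
Proof.
move=> ab; rewrite -[a]add0n -(subnK ab) !big_addn; move: (b - a)%N => d.
rewrite addnK; elim: d => [|d IHd].
  by rewrite !big_geq // !add0n mulr0 subrr addr0.
rewrite !big_nat_recr //= mulrDr IHd !addSn !exprS; ring.
Qed.

(** Summation by parts replaces h by its differences and so gains a factor
    1 / n, at the price of dividing by 1 - w. *)
Lemma dirichlet_test w h C : `|w| = 1 -> w != 1 -> 0 <= C ->
  (forall n, (0 < n)%N -> `|h n| <= C / n%:R) ->
  (forall n, (0 < n)%N -> `|h n.+1 - h n| <= C / n%:R ^+ 2) ->
  tail_bounded (fun n => h n * w ^+ n).
Proof.
move=> w1 wn1 C0 hh dh;
  have w10 : 0 < `|1 - w| by rewrite normr_gt0 subr_eq0 eq_sym.
exists (4 * C / `|1 - w|) => [|a b ab]; first by rewrite !mulr_ge0 ?ler0n ?invr_ge0.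
have [a0 ab'] := andP ab; have b0 : (0 < b)%N by lia.
rewrite mulrAC ler_pdivlMr // mulrC -normrM abel_summation //.
have wX n : `|w ^+ n| = 1 by rewrite normrX w1 expr1n.
have -> : 4 * C / a%:R = C / a%:R + C / a%:R + C * (2 / a%:R) by ring.
apply: (le_trans (ler_normD _ _)); apply: lerD.
  apply: (le_trans (ler_normB _ _)); rewrite !normrM !wX !mulr1; apply: lerD.
    exact: hh.
  apply: le_trans (hh b b0) _; rewrite ler_wpM2l // lef_pV2 ?posrE ?ltr0n //.
  by rewrite ler_nat.
apply: (le_trans (ler_norm_sum _ _ _)).
apply: le_trans (_ : \sum_(a <= n < b) C / n%:R ^+ 2 <= _).
  rewrite !big_seq; apply: ler_sum => n; rewrite mem_index_iota => /andP[an _].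
  by rewrite normrM wX mulr1; apply: dh; lia.
by rewrite -mulr_sumr ler_wpM2l // sum_inv_sq_le.
Qed.

(** Bounded sequences of variation O(1 / n): the numerators for which
    summation by parts applies to the exponent 1.  The partial sums t_n and
    zeta_n, and their products, are of this kind. *)
Definition tame g := exists2 C : K, 0 <= C & forall n, (0 < n)%N ->
  `|g n| <= C /\ `|g n.+1 - g n| <= C / n%:R.

Lemma tame_cst c : tame (fun=> c).
Proof.
exists `|c| => // n n0; split => //.
by rewrite subrr normr0 divr_ge0 ?ler0n.
Qed.

Lemma tameM g h : tame g -> tame h -> tame (fun n => g n * h n).
Proof.
move=> [C C0 hg] [D D0 hh]; exists (C * D *+ 2) => [|n n0].
  by rewrite mulrn_wge0 ?mulr_ge0.
have [g1 g2] := hg n n0; have [h1 h2] := hh n n0; have [h3 _] := hh n.+1 isT.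
split.
  apply: le_trans (_ : C * D <= _); first by rewrite normrM ler_pM.
  by rewrite mulr2n lerDl mulr_ge0.
have -> : g n.+1 * h n.+1 - g n * h n
  = (g n.+1 - g n) * h n.+1 + g n * (h n.+1 - h n) by ring.
apply: (le_trans (ler_normD _ _)).
have -> : C * D *+ 2 / n%:R = C / n%:R * D + C * (D / n%:R) by ring.
by rewrite !normrM; apply: lerD; apply: ler_pM.
Qed.

Lemma half_lt_shift th n : 0 <= th <= 2^-1 -> (0 < n)%N ->
  n%:R / 2 <= n%:R - th /\ 0 < n%:R - th.
Proof.
move=> /andP[_ th1] n0; have h : n%:R / 2 <= n%:R - th.
  rewrite lerBrDr -lerBrDl.
  have -> : n%:R - n%:R / 2 = n%:R / 2 :> K by field.
  by apply: le_trans th1 _; rewrite ler_peMl ?invr_ge0 ?ler0n // ler1n.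
by split => //; apply: lt_le_trans h; rewrite divr_gt0 ?ltr0n.
Qed.

Lemma inv_shift_le th n : 0 <= th <= 2^-1 -> (0 < n)%N ->
  `|(n%:R - th)^-1| <= 2 / n%:R.
Proof.
move=> hth n0; have [h1 h2] := half_lt_shift hth n0.
rewrite ger0_norm; last by rewrite invr_ge0 ltW.
have -> : 2 / n%:R = (n%:R / 2)^-1 :> K by rewrite invf_div.
by rewrite lef_pV2 ?posrE // divr_gt0 ?ltr0n.
Qed.

Lemma inv_shiftX_le th p n : 0 <= th <= 2^-1 -> (0 < n)%N -> (0 < p)%N ->
  `|((n%:R - th) ^+ p)^-1| <= 2 ^+ p / n%:R.
Proof.
move=> hth n0 p0; rewrite -exprVn normrX.
apply: (@le_trans _ _ ((2 / n%:R) ^+ p)).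
  by rewrite lerXn2r ?nnegrE ?divr_ge0 ?ler0n // inv_shift_le.
rewrite expr_div_n ler_wpM2l ?exprn_ge0 ?ler0n //.
rewrite lef_pV2 ?posrE ?exprn_gt0 ?ltr0n // -natrX ler_nat.
by rewrite -{1}[n]expn1 leq_pexp2l.
Qed.

(** For exponent 1 this is [dirichlet_test], as w is different from 1 by
    hypothesis; for larger exponents the series is dominated by 1 / n^2.
    The shift th is 0 for zeta_n and Li, and 1 / 2 for t_n and ti. *)
Lemma tame_series_bounded th q w g : 0 <= th <= 2^-1 -> `|w| = 1 ->
  (0 < q)%N -> (q, w) <> (1%N, 1) -> tame g ->
  tail_bounded (fun n => g n / (n%:R - th) ^+ q * w ^+ n).
Proof.
move=> hth w1; case: q => [//|[|q]] _ qw [C C0 hg].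
  have wn1 : w != 1 by apply/eqP => w1'; apply: qw; rewrite w1'.
  apply: (@dirichlet_test _ (fun n => g n / (n%:R - th) ^+ 1) (6 * C)) => //.
  - by rewrite mulr_ge0 ?ler0n.
  - move=> n n0; have [g1 _] := hg n n0; rewrite expr1 normrM.
    apply: le_trans (ler_pM _ _ g1 (inv_shift_le hth n0)) _ => //.
    rewrite mulrA ler_wpM2r ?invr_ge0 ?ler0n // mulrC ler_wpM2r //.
    by rewrite ler_nat.
  - move=> n n0; have [g1 g2] := hg n n0; rewrite !expr1.
    have [_ p1] := half_lt_shift hth n0.
    have [_ p2] := half_lt_shift hth (ltn0Sn n).
    have -> : g n.+1 / (n.+1%:R - th) - g n / (n%:R - th) =
      (g n.+1 - g n) * (n.+1%:R - th)^-1
      - g n * ((n%:R - th)^-1 * (n.+1%:R - th)^-1).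
      by move: p1 p2; rewrite -natr1 => p1 p2; field; rewrite !gt_eqF.
    have i1 := inv_shift_le hth n0.
    have i2 : `|(n.+1%:R - th)^-1| <= 2 / n%:R.
      apply: le_trans (inv_shift_le hth (ltn0Sn n)) _.
      by rewrite ler_wpM2l ?ler0n // lef_pV2 ?posrE ?ltr0n // ler_nat.
    apply: (le_trans (ler_normB _ _)).
    have -> : 6 * C / n%:R ^+ 2
       = C / n%:R * (2 / n%:R) + C * (2 / n%:R * (2 / n%:R)) :> K.
      by field; rewrite pnatr_eq0 -lt0n.
    rewrite !normrM; apply: lerD; first exact: ler_pM.
    by apply: ler_pM; rewrite ?mulr_ge0 //; apply: ler_pM.
have C2 : 0 <= C * 2 ^+ q.+2 by rewrite mulr_ge0 ?exprn_ge0 ?ler0n.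
exists (C * 2 ^+ q.+2 * 2) => [|a b ab]; first by rewrite mulr_ge0 ?ler0n.
apply: (le_trans (ler_norm_sum _ _ _)).
apply: le_trans (_ : \sum_(a <= n < b) C * 2 ^+ q.+2 * (n%:R ^+ 2)^-1 <= _).
  rewrite !big_seq; apply: ler_sum => n; rewrite mem_index_iota => /andP[an _].
  have n0 : (0 < n)%N by have := andP ab; lia.
  have [g1 _] := hg n n0; rewrite !normrM normrX w1 expr1n mulr1.
  rewrite -mulrA; apply: ler_pM => //.
  rewrite -[(_ - th) ^- _]exprVn normrX.
  apply: (@le_trans _ _ ((2 / n%:R) ^+ q.+2)).
    by rewrite lerXn2r ?nnegrE ?divr_ge0 ?ler0n // inv_shift_le.
  rewrite expr_div_n ler_wpM2l ?exprn_ge0 ?ler0n //.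
  rewrite lef_pV2 ?posrE ?exprn_gt0 ?ltr0n // -!natrX ler_nat.
  by rewrite leq_pexp2l.
rewrite -mulr_sumr -[leRHS]mulrA ler_wpM2l //; exact: sum_inv_sq_le.
Qed.

Lemma zero_shift : 0 <= (0 : K) <= 2^-1.
Proof. by rewrite lexx invr_ge0 ler0n. Qed.

Lemma half_shift : 0 <= (2^-1 : K) <= 2^-1.
Proof. by rewrite lexx invr_ge0 ler0n. Qed.

Lemma polylog_tail_bounded th p z : 0 <= th <= 2^-1 -> `|z| = 1 ->
  (0 < p)%N -> (p, z) <> (1%N, 1) ->
  tail_bounded (fun n => z ^+ n / (n%:R - th) ^+ p).
Proof.
move=> hth z1 p0 pz.
have [C C0 hC] := tame_series_bounded hth z1 p0 pz (tame_cst 1).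
exists C => // a b /hC; congr (`|_| <= _); apply: eq_bigr => n _.
by rewrite div1r mulrC.
Qed.

Lemma tame_partial_sum th p z : 0 <= th <= 2^-1 -> `|z| = 1 ->
  (0 < p)%N -> (p, z) <> (1%N, 1) ->
  tame (fun n => \sum_(1 <= k < n.+1) z ^+ k / (k%:R - th) ^+ p).
Proof.
move=> hth z1 p0 pz.
have [C C0 hC] := polylog_tail_bounded hth z1 p0 pz.
exists (C + 2 ^+ p) => [|n n0]; first by rewrite addr_ge0 ?exprn_ge0 ?ler0n.
split.
  apply: le_trans (hC 1%N n.+1 _) _; first by lia.
  by rewrite divr1 lerDl exprn_ge0 ?ler0n.
rewrite [in X in X - _]big_nat_recr //=.
rewrite addrAC subrr add0r normrM normrX z1 expr1n mul1r.
apply: le_trans (inv_shiftX_le hth (ltn0Sn n) p0) _.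
apply: ler_pM; rewrite ?exprn_ge0 ?invr_ge0 ?ler0n // ?lerDr //.
by rewrite lef_pV2 ?posrE ?ltr0n // ler_nat.
Qed.

Lemma tame_tn p z : `|z| = 1 -> (0 < p)%N -> (p, z) <> (1%N, 1) ->
  tame (fun n => tn n p z).
Proof. exact: (tame_partial_sum half_shift). Qed.

Lemma tame_zetan p z : `|z| = 1 -> (0 < p)%N -> (p, z) <> (1%N, 1) ->
  tame (fun n => zetan n p z).
Proof.
move=> z1 p0 pz; have [C C0 hC] := tame_partial_sum zero_shift z1 p0 pz.
have e n : zetan n p z = \sum_(1 <= k < n.+1) z ^+ k / (k%:R - 0) ^+ p.
  by apply: eq_bigr => i _; rewrite subr0.
by exists C => // n n0; rewrite !e; exact: hC.
Qed.

End Bounds.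

(** * Completeness of the complex numbers *)

(** This property and the next one are all that the convergence arguments use
    of the complex numbers: they are archimedean, and sequences that are Cauchy
    at rate 1 / m converge. *)
Definition harmonic_null (K : numFieldType) : Prop :=
  ((fun n : nat => n.+1%:R^-1 : K) @ \oo --> (0 : K))%classic.

Definition harmonic_complete (K : numFieldType) : Prop :=
  forall (C : K) (u : nat -> K),
    (forall m n, (0 < m <= n)%N -> `|u n - u m| <= C / m%:R) -> cvgn u.

Section Complex.
Local Open Scope classical_set_scope.
Local Open Scope complex_scope.
Variable R : realType.

Lemma natc n : (n%:R : R[i]) = (n%:R : R)%:C.
Proof. by rewrite rmorph_nat. Qed.

Lemma complex_real_gt0 (e : R[i]) : 0 < e -> exists2 r : R, 0 < r & e = r%:C.
Proof.
case: e => a b; rewrite ltcE /= => /andP[/eqP -> a0]; exists a => //.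
Qed.

Lemma complex_harmonic_null : harmonic_null R[i].
Proof.
apply/cvgr0Pnorm_le => e /complex_real_gt0[r r0 ->].
have /cvgr0Pnorm_le/(_ r r0) := @cvg_harmonic R.
apply: filterS => n; rewrite /harmonic => h.
rewrite natc -fmorphV /= normc_def /= expr0n addr0 sqrtr_sqr.
by rewrite lecR.
Qed.

Lemma normc_ge_Im (z : R[i]) : `|complex.Im z|%:C <= `|z|.
Proof.
have -> : complex.Im z = complex.Re ('i%C * - z) by case: z => a b /=; ring.
apply: le_trans (normc_ge_Re _) _.
by rewrite normrM normrN normCi mul1r.
Qed.

Lemma complex_norm_le (z : R[i]) : `|z| <= (`|complex.Re z| + `|complex.Im z|)%:C.
Proof.
rewrite [in X in X <= _](complexE z) rmorphD /=.
apply: le_trans (ler_normD _ _) _.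
rewrite normrM normCi mul1r !normc_def /= !expr0n /= !addr0 !sqrtr_sqr.
exact: lexx.

Qed.

Lemma real_harmonic_complete (c : R) (u : nat -> R) :
  (forall m n, (0 < m <= n)%N -> `|u n - u m| <= c / m%:R) -> cvgn u.
Proof.
move=> hu; apply: R_complete; apply: cauchy_exP => e e0.
have c0 : 0 <= c.
  by have := hu 1%N 1%N isT; rewrite subrr normr0 divr1.
have [M _ hM] : \forall m \near \oo, (c + 1) / m.+1%:R < e.
  have /cvgr0Pnorm_lt/(_ (e / (c + 1))) := @cvg_harmonic R.
  have c1 : 0 < c + 1 by rewrite ltr_wpDl.
  move=> /(_ (divr_gt0 e0 c1)); apply: filterS => m.
  rewrite /harmonic ger0_norm ?invr_ge0 ?ler0n // => h.
  by rewrite mulrC -ltr_pdivlMr.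
exists (u M.+1); exists M.+1 => // n /= Mn.
rewrite /ball /= distrC; apply: le_lt_trans (hu M.+1 n _) _; first by [].
apply: le_lt_trans (hM M _) => //=.
by rewrite ler_wpM2r ?invr_ge0 ?ler0n // lerDl.
Qed.

Lemma complex_harmonic_complete : harmonic_complete R[i].
Proof.
move=> C u hu.
have C0 : 0 <= C by have := hu 1%N 1%N isT; rewrite subrr normr0 divr1.
have [c hc] : exists c : R, C = c%:C.
  by exists (complex.Re C); rewrite RRe_real // ger0_real.
have toR m n : (0 < m <= n)%N -> `|u n - u m| <= (c / m%:R)%:C.
  by move=> /hu; rewrite hc natc -fmorphV -rmorphM.
have /cvg_ex[/= a ha] : cvgn (fun n => complex.Re (u n)).
  apply: (@real_harmonic_complete c) => m n /toR mn; rewrite -lecR.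
  by apply: le_trans mn; rewrite -raddfB normc_ge_Re.
have /cvg_ex[/= b hb] : cvgn (fun n => complex.Im (u n)).
  apply: (@real_harmonic_complete c) => m n /toR mn; rewrite -lecR.
  by apply: le_trans mn; rewrite -raddfB normc_ge_Im.
apply: (@cvgP _ (u @ \oo) (a +i* b)); apply/cvgrPdist_le => e.
move=> /complex_real_gt0[r r0 ->].
have r2 : 0 < r / 2 by rewrite divr_gt0.
move: ha hb => /cvgrPdist_le/(_ _ r2) ha /cvgrPdist_le/(_ _ r2) hb.
near=> n; apply: le_trans (complex_norm_le _) _; rewrite lecR.
rewrite (splitr r) !raddfB /=; apply: lerD; near: n; [exact: ha|exact: hb].
Unshelve. all: by end_near.
Qed.

End Complex.

(** * Limits of sequences and the harmonic convolution *)

Section Limits.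
Local Open Scope classical_set_scope.
Variable K : numFieldType.
Implicit Types (f g h u : nat -> K) (w z C th : K).

Lemma cvg0_le u (v : nat -> K) : (forall n, (0 < n)%N -> `|u n| <= v n) ->
  v @ \oo --> (0 : K) -> u @ \oo --> (0 : K).
Proof.
move=> uv /cvgr0Pnorm_le v0; apply/cvgr0Pnorm_le => e e0.
have hv := v0 e e0; near=> n.
have n0 : (0 < n)%N by near: n; exact: nbhs_infty_gt.
apply: le_trans (uv n n0) _; apply: le_trans (_ : `|v n| <= _).
  by rewrite ger0_norm //; apply: le_trans (uv n n0).
near: n; exact: hv.
Unshelve. all: by end_near.
Qed.

Lemma cvg_sum_seq (I : Type) (r : seq I) (P : pred I) (F : I -> nat -> K)
    (l : I -> K) :
  (forall i, P i -> F i @ \oo --> l i) ->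
  (fun n => \sum_(i <- r | P i) F i n) @ \oo --> \sum_(i <- r | P i) l i.
Proof.
by move=> hF; apply: cvg_big; first exact: add_continuous.
Qed.

Lemma cvg_eq0 u v (l : K) : u @ \oo --> l ->
  (fun n => u n - v n) @ \oo --> (0 : K) ->
  v @ \oo --> l.
Proof.
move=> ul uv0.
have : (fun n => u n - (u n - v n)) @ \oo --> l - 0 by exact: cvgB.
by rewrite subr0; under eq_fun do rewrite subKr.
Qed.

Lemma cvg_lim_le u (l a : K) (B : K) : u @ \oo --> l ->
  (\forall n \near \oo, `|a - u n| <= B) -> `|a - l| <= B.
Proof.
move=> ul hB; apply/ler_addgt0Pr => e e0.
move/cvgrPdist_le: ul => /(_ e e0) ul.
near \oo => n; rewrite -(subrKA (u n)) (le_trans (ler_normD _ _)) //.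
apply: lerD; first by near: n; exact: hB.
by rewrite distrC; near: n; exact: ul.
Unshelve. all: by end_near.
Qed.

Hypothesis hnull : harmonic_null K.

Lemma cvg_harmonicZ C : (fun N => C / N%:R) @ \oo --> (0 : K).
Proof.
rewrite -(@cvg_shiftS K) /=.
have : (fun N => C * N.+1%:R^-1) @ \oo --> C * 0.
  by apply: cvgM; [exact: cvg_cst|exact: hnull].
by rewrite mulr0.
Qed.

(** Total error of the truncation at N: an error 1 / n from the exponent
    1 times an error 1 / (N + 1 - n) from the missing tail. *)
Definition harmonic_convolution (N : nat) : K :=
  \sum_(1 <= n < N.+1) (n%:R * (N.+1 - n)%:R)^-1.

(** Each of the first k terms is at most 1, the others are at most 1 / k.  This
    replaces the logarithm in the bound of the harmonic sum. *)
Lemma harmonic_sum_le k N : (0 < k)%N ->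
  \sum_(1 <= n < N.+1) n%:R^-1 <= k%:R + N%:R / k%:R :> K.
Proof.
move=> k0; elim: N => [|N IHN].
  by rewrite big_geq // mul0r addr0 ler0n.
rewrite big_nat_recr //=.
have [Nk|kN] := leqP N.+1 k.
  apply: le_trans (_ : N.+1%:R <= _); last first.
    apply: le_trans (_ : k%:R <= _); first by rewrite ler_nat.
    by rewrite lerDl divr_ge0 ?ler0n.
  rewrite -[in leRHS]natr1; apply: lerD; last first.
    by rewrite invf_le1 ?ltr0n // ler1n.
  apply: le_trans (_ : \sum_(1 <= n < N.+1) 1 <= _).
    rewrite !big_seq; apply: ler_sum => n; rewrite mem_index_iota => /andP[n0 _].
    by rewrite invf_le1 ?ltr0n // ler1n.
  by rewrite sumr_const_nat subn1.
apply: le_trans (lerD IHN (lexx _)) _.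
rewrite -addrA lerD2l -[in leRHS]natr1 mulrDl lerD2l mul1r.
by rewrite lef_pV2 ?posrE ?ltr0n // ler_nat ltnW.
Qed.

(** Partial fractions and the symmetry n -> N + 1 - n. *)
Lemma harmonic_convolutionE N :
  harmonic_convolution N = 2 / N.+1%:R * \sum_(1 <= n < N.+1) n%:R^-1.
Proof.
rewrite /harmonic_convolution.
have -> : 2 / N.+1%:R * \sum_(1 <= n < N.+1) n%:R^-1 = N.+1%:R^-1 *
  (\sum_(1 <= n < N.+1) n%:R^-1 + \sum_(1 <= n < N.+1) n%:R^-1) :> K by ring.
rewrite [X in _ + X]big_nat_rev /= -big_split /= mulr_sumr.
rewrite !big_seq; apply: eq_bigr => n; rewrite mem_index_iota => /andP[n0 nN].
rewrite add1n subSS.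
have -> : (N.+1%:R : K) = n%:R + (N.+1 - n)%:R by rewrite -natrD subnKC // ltnW.
have h1 : n%:R != 0 :> K by rewrite pnatr_eq0 -lt0n.
have h2 : (N.+1 - n)%:R != 0 :> K by rewrite pnatr_eq0 subn_eq0 -ltnNge.
have h3 : n%:R + (N.+1 - n)%:R != 0 :> K.
  by rewrite -natrD subnKC ?pnatr_eq0 // ltnW.
by field; rewrite h1 h2 h3.
Qed.

Lemma harmonic_convolution_cvg0 : harmonic_convolution @ \oo --> (0 : K).
Proof.
apply/cvgr0Pnorm_le => e e0.
have e4 : 0 < e / 4 by rewrite divr_gt0 ?ltr0n.
have /cvgr0Pnorm_le/(_ _ e4)[k _ /(_ k (leqnn k)) /=] := hnull.
rewrite ger0_norm ?invr_ge0 ?ler0n // => hk.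
(* this size of N balances the two terms of [harmonic_sum_le] *)
exists (k.+1 ^ 2)%N => // N /= hN.
have kk : k.+1%:R != 0 :> K by rewrite pnatr_eq0.
have S0 : 0 <= \sum_(1 <= n < N.+1) n%:R^-1 :> K.
  by apply: sumr_ge0 => n _; rewrite invr_ge0 ler0n.
have N2 : 0 <= 2 / N.+1%:R :> K by rewrite divr_ge0 ?ler0n.
rewrite harmonic_convolutionE ger0_norm; last exact: mulr_ge0.
apply: le_trans (ler_wpM2l N2 (harmonic_sum_le N (ltn0Sn k))) _.
apply: le_trans (_ : 2 / N.+1%:R * (N.+1%:R / k.+1%:R + N.+1%:R / k.+1%:R) <= _).
  rewrite ler_wpM2l // lerD //.
    rewrite ler_pdivlMr ?ltr0n // -natrM ler_nat; apply: leq_trans (leqnSn N).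
    by rewrite mulnn.
  by rewrite ler_wpM2r ?invr_ge0 ?ler0n // ler_nat.
have -> : 2 / N.+1%:R * (N.+1%:R / k.+1%:R + N.+1%:R / k.+1%:R)
    = 4 * k.+1%:R^-1 :> K.
  have : N.+1%:R != 0 :> K by rewrite pnatr_eq0.
  by move: kk; move: (N.+1%:R : K) (k.+1%:R : K) => a b b0 a0; field; rewrite a0 b0.
by rewrite mulrC -ler_pdivlMr ?ltr0n.
Qed.

Hypothesis hcompl : harmonic_complete K.

Lemma tail_bounded_cvg f : tail_bounded f ->
  cvgn (fun N => \sum_(1 <= n < N) f n).
Proof.
move=> [C C0 hC]; apply: (hcompl (C := C)) => m n mn.
have [m0 mn'] := andP mn.
by rewrite (big_cat_nat (n := m)) //= addrAC subrr add0r hC.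
Qed.

Lemma tail_bounded_lim f : tail_bounded f ->
  exists2 C : K, 0 <= C & forall N, (0 < N)%N ->
  `|limn (fun N => \sum_(1 <= n < N) f n) - \sum_(1 <= n < N) f n| <= C / N%:R.
Proof.
move=> hf; have := tail_bounded_cvg hf; case: hf => [C C0 hC] hcv.
exists C => // N N0; rewrite distrC; apply: (cvg_lim_le hcv).
exists N => // n /= Nn; rewrite distrC (big_cat_nat (n := N)) //=.
by rewrite addrAC subrr add0r hC // N0.
Qed.

End Limits.

(** * Bilateral sums over the half-integers *)

Section Series.
Local Open Scope classical_set_scope.
Variable K : numFieldType.
Hypothesis hnull : harmonic_null K.
Hypothesis hcompl : harmonic_complete K.
Implicit Types (z w : K) (p q n m j M N : nat).

Lemma ti_cvg p z : `|z| = 1 -> (0 < p)%N -> (p, z) <> (1%N, 1) ->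
  (fun N => \sum_(1 <= n < N) z ^+ n / (n%:R - 2^-1) ^+ p) @ \oo --> ti p z.
Proof.
by move=> z1 p0 pz; apply: tail_bounded_cvg => //;
  apply: polylog_tail_bounded => //; exact: half_shift.
Qed.

Lemma polylog_termE p z n :
  z ^+ n / (n%:R - 0) ^+ p = z ^+ n / n%:R ^+ p.
Proof. by rewrite subr0. Qed.

Lemma Li_tail_bounded p z : `|z| = 1 -> (0 < p)%N -> (p, z) <> (1%N, 1) ->
  tail_bounded (fun n => z ^+ n / n%:R ^+ p).
Proof.
move=> z1 p0 pz; have := polylog_tail_bounded (zero_shift K) z1 p0 pz.
by under eq_fun do rewrite polylog_termE.
Qed.

Lemma Li_cvg p z : `|z| = 1 -> (0 < p)%N -> (p, z) <> (1%N, 1) ->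
  (fun N => \sum_(1 <= n < N) z ^+ n / n%:R ^+ p) @ \oo --> Li p z.
Proof. by move=> *; apply: tail_bounded_cvg => //; exact: Li_tail_bounded. Qed.

Lemma Tlin_cvg p q z w : `|z| = 1 -> `|w| = 1 -> (0 < p)%N -> (0 < q)%N ->
  (p, z) <> (1%N, 1) -> (q, w) <> (1%N, 1) ->
  (fun N => \sum_(1 <= n < N) tn n p z / (n%:R - 2^-1) ^+ q * w ^+ n)
    @ \oo --> Tlin p q z w.
Proof.
move=> z1 w1 p0 q0 pz qw; apply: tail_bounded_cvg => //.
by apply: tame_series_bounded => //; [exact: half_shift|exact: tame_tn].
Qed.

Lemma Tquad_cvg p p' q z z' w : `|z| = 1 -> `|z'| = 1 -> `|w| = 1 ->
  (0 < p)%N -> (0 < p')%N -> (0 < q)%N ->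
  (p, z) <> (1%N, 1) -> (p', z') <> (1%N, 1) -> (q, w) <> (1%N, 1) ->
  (fun N => \sum_(1 <= n < N)
     tn n p z * tn n p' z' / (n%:R - 2^-1) ^+ q * w ^+ n)
    @ \oo --> Tquad p p' q z z' w.
Proof.
move=> z1 z1' w1 p0 p0' q0 pz pz' qw; apply: tail_bounded_cvg => //.
apply: tame_series_bounded => //; first exact: half_shift.
by apply: tameM; exact: tame_tn.
Qed.

Lemma Slin_cvg p q z w : `|z| = 1 -> `|w| = 1 -> (0 < p)%N -> (0 < q)%N ->
  (p, z) <> (1%N, 1) -> (q, w) <> (1%N, 1) ->
  (fun N => \sum_(1 <= n < N) zetan n p z / n%:R ^+ q * w ^+ n)
    @ \oo --> Slin p q z w.
Proof.
move=> z1 w1 p0 q0 pz qw; apply: tail_bounded_cvg => //.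
have := tame_series_bounded (zero_shift K) w1 q0 qw (tame_zetan z1 p0 pz).
by under eq_fun do rewrite subr0.
Qed.

(** The sum of x^(1 - n) * f(n - 1/2) over 1 - M < n < M, with n and 1 - n
    grouped together: the symmetric grouping makes the simple pole with x = 1
    summable. *)
Definition bilateral_sum (x : K) (f : K -> K) (M : nat) : K :=
  \sum_(1 <= n < M) (x * x^-1 ^+ n * f (n%:R - 2^-1)
                     + x ^+ n * f (- (n%:R - 2^-1))).

Lemma inv_unit_neq1 x : (x^-1 == 1 :> K) = (x == 1).
Proof. by rewrite -{1}invr1 (inj_eq invr_inj). Qed.

Lemma pair_neq1V p x : (p, x) <> (1%N, 1 : K) -> (p, x^-1) <> (1%N, 1 : K).
Proof.
by move=> h [p1 /eqP]; rewrite inv_unit_neq1 => /eqP x1; apply: h; rewrite p1 x1.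
Qed.

Lemma norm_inv1 x : `|x| = 1 -> `|x^-1 : K| = 1.
Proof.
by move=> x1; rewrite normrV ?x1 ?invr1 // unitfE -normr_eq0 x1 oner_eq0.
Qed.

Lemma bilateral_sum_pole0 x m : `|x| = 1 ->
  bilateral_sum x (fun s => (s ^+ m.+1)^-1) @ \oo --> - ti_factor m x.
Proof.
move=> x1; rewrite /ti_factor; case: ifPn => [/andP[/eqP -> /eqP ->]|hmx].
  (* the function 1 / s is odd, so that each symmetric pair cancels *)
  have -> : bilateral_sum 1 (fun s => (s ^+ 1)^-1) = fun=> 0.
    apply/funext => M; apply: big1 => n _.
    by rewrite invr1 !expr1n !mul1r !expr1 invrN subrr.
  by rewrite oppr0; exact: cvg_cst.
have hx : (m.+1, x) <> (1%N, 1) by move=> [m0 x10]; rewrite m0 x10 !eqxx in hmx.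
have c1 := ti_cvg x1 (ltn0Sn m) hx.
have c2 := ti_cvg (norm_inv1 x1) (ltn0Sn m) (pair_neq1V hx).
have -> : bilateral_sum x (fun s => (s ^+ m.+1)^-1) = fun M =>
  x * (\sum_(1 <= n < M) x^-1 ^+ n / (n%:R - 2^-1) ^+ m.+1)
  - (-1) ^+ m * (\sum_(1 <= n < M) x ^+ n / (n%:R - 2^-1) ^+ m.+1).
  apply/funext => M; rewrite /bilateral_sum !mulr_sumr -sumrB;
    apply: eq_bigr => n _.
  rewrite [(- (_ - _)) ^+ _]exprNn invfM -[((-1) ^+ _)^-1]exprVn invrN1.
  by rewrite [(-1) ^+ _.+1]exprS; ring.
by rewrite opprB; apply: cvgB; apply: cvgM => //; exact: cvg_cst.
Qed.

Lemma bilateral_sum_recr x f M : bilateral_sum x f M.+2 = bilateral_sum x f M.+1 +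
  (x * x^-1 ^+ M.+1 * f (M.+1%:R - 2^-1) + x ^+ M.+1 * f (- (M.+1%:R - 2^-1))).
Proof. by rewrite /bilateral_sum big_nat_recr. Qed.

(** Translating f by 1 shifts the window of summation by one step, hence only
    the two extreme terms remain. *)
Lemma bilateral_sum_shift x f M : x != 0 ->
  bilateral_sum x (fun s => f (s + 1)) M.+1 =
  x * (bilateral_sum x f M.+1 + x^-1 ^+ M * f (M.+1%:R - 2^-1)
       - x ^+ M * f (- (M%:R - 2^-1))).
Proof.
move=> x0; elim: M => [|M IHM].
  rewrite /bilateral_sum !big_geq // add0r !expr0 !mul1r.
  have -> : - (0 - 2^-1) = 1 - 2^-1 :> K by field.
  by rewrite subrr mulr0.
rewrite !bilateral_sum_recr IHM.
have -> : M.+1%:R - 2^-1 + 1 = M.+2%:R - 2^-1 :> K by rewrite -[in RHS]natr1; ring.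
have -> : - (M.+1%:R - 2^-1) + 1 = - (M%:R - 2^-1) :> K by rewrite -natr1; ring.
rewrite !exprS; field.
by rewrite x0.
Qed.

Lemma half_int_inv_cvg0 p :
  (fun n => ((n%:R - 2^-1) ^+ p.+1)^-1 : K) @ \oo --> (0 : K).
Proof.
apply: cvg0_le (cvg_harmonicZ hnull (2 ^+ p.+1)) => n n0.
by apply: inv_shiftX_le => //; exact: half_shift.
Qed.

Lemma unimodular_cvg0 (w u : nat -> K) : (forall n, `|w n| = 1) ->
  u @ \oo --> (0 : K) -> (fun n => w n * u n) @ \oo --> (0 : K).
Proof.
move=> w1 u0; apply: (@cvg0_le _ _ (fun n => `|u n|)) => [n _|].
  by rewrite normrM w1 mul1r.
have := cvg_norm u0; rewrite normr0 => h; exact: h.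
Qed.

(** By [bilateral_sum_shift], each translation multiplies the value by x, as the
    boundary terms tend to 0. *)
Lemma bilateral_sum_pole x m j : `|x| = 1 ->
  bilateral_sum x (fun s => ((s + j%:R) ^+ m.+1)^-1) @ \oo
    --> - (x ^+ j * ti_factor m x).
Proof.
move=> x1; have x0 : x != 0 by rewrite -normr_eq0 x1 oner_eq0.
elim: j => [|j IHj].
  rewrite expr0 mul1r; under [X in bilateral_sum _ X]eq_fun do rewrite addr0.
  exact: bilateral_sum_pole0.
pose f (s : K) := ((s + j%:R) ^+ m.+1)^-1.
have -> : (fun s : K => ((s + j.+1%:R) ^+ m.+1)^-1) = (fun s => f (s + 1)).
  by apply/funext => s; rewrite /f -natr1 -addrA [1 + _]addrC.
suff h : (fun M => x * (bilateral_sum x f M.+1 + x^-1 ^+ M * f (M.+1%:R - 2^-1)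
       - x ^+ M * f (- (M%:R - 2^-1)))) @ \oo
    --> x * (- (x ^+ j * ti_factor m x) + 0 - 0).
  rewrite exprS -mulrA -mulrN -[- (_ * _)]addr0 -[X in _ * X]subr0.
  rewrite -(@cvg_shiftS K); apply: cvg_trans h.
  by apply: near_eq_cvg; near=> n; rewrite /= -bilateral_sum_shift.
apply: cvgM; first exact: cvg_cst.
apply: cvgB.
  apply: cvgD; first by rewrite (@cvg_shiftS K).
  apply: unimodular_cvg0 => [n|]; first by rewrite normrX norm_inv1 // expr1n.
  have := half_int_inv_cvg0 m; rewrite -(cvg_shiftn j.+1) /=; apply: cvg_trans.
  apply: near_eq_cvg; near=> n; rewrite /f /=; congr ((_ ^+ _)^-1).
  by rewrite addnS -addSn natrD; ring.
apply: unimodular_cvg0 => [n|]; first by rewrite normrX x1 expr1n.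
have h : (fun n => (- 1) ^+ m.+1 * (((n - j)%:R - 2^-1) ^+ m.+1)^-1 : K) @ \oo -->
  (0 : K).
  apply: unimodular_cvg0 => [n|]; first by rewrite normrX normrN1 expr1n.
  rewrite -(cvg_shiftn j) /=; under eq_fun do rewrite addnK.
  exact: half_int_inv_cvg0.
apply: cvg_trans h; apply: near_eq_cvg; near=> n.
have nj : (j <= n)%N by near: n; exact: nbhs_infty_ge.
have -> : f (- (n%:R - 2^-1)) = ((- ((n - j)%:R - 2^-1)) ^+ m.+1)^-1.
  by rewrite /f natrB //; congr ((_ ^+ _)^-1); ring.
by rewrite [(- (_ - _)) ^+ _]exprNn invfM -[((-1) ^+ _)^-1]exprVn invrN1.
Unshelve. all: by end_near.
Qed.

End Series.

(** * Bilateral sum of a product of three inverse powers *)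

Section Residues.
Local Open Scope classical_set_scope.
Variable K : numFieldType.
Hypothesis hnull : harmonic_null K.
Hypothesis hcompl : harmonic_complete K.
Implicit Types (x z w : K) (f g : K -> K) (p q n m j k l M N : nat).

(** The points at which a bilateral sum evaluates its function. *)
Definition half_integer (s : K) := exists n,
  s = n.+1%:R - 2^-1 \/ s = - (n.+1%:R - 2^-1).

(** A zero would make an odd number equal to an even one. *)
Lemma half_integerDn_neq0 s j : half_integer s -> s + j%:R != 0.
Proof.
move=> [n [->|->]]; apply/eqP => h.
  have : (2 * (n + j) + 1)%:R = 0 :> K.
    by rewrite natrD natrM natrD; move: h; rewrite -natr1 => /(congr1 ( *%R 2));
      rewrite mulr0 => <-; field.
  by move/eqP; rewrite pnatr_eq0 addn1.
have : (2 * j + 1)%:R = (2 * n.+1)%:R :> K.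
  rewrite natrD !natrM; move/(congr1 ( *%R 2)): h; rewrite mulr0 => h.
  by apply/eqP; rewrite -subr_eq0 -h; apply/eqP; field.
by move/eqP; rewrite eqr_nat => /eqP; lia.
Qed.

Lemma half_integer_neq0 s : half_integer s -> s != 0.
Proof. by move/(half_integerDn_neq0 0); rewrite addr0. Qed.

Lemma eq_bilateral_sum x f g M : (forall s, half_integer s -> f s = g s) ->
  bilateral_sum x f M = bilateral_sum x g M.
Proof.
move=> fg; rewrite /bilateral_sum !big_seq; apply: eq_bigr => -[|n].
  by rewrite mem_index_iota.
move=> _; rewrite !fg //; by [exists n; right|exists n; left].
Qed.

Lemma bilateral_sumD x f g M :
  bilateral_sum x (fun s => f s + g s) M = bilateral_sum x f M
    + bilateral_sum x g M.
Proof. by rewrite /bilateral_sum -big_split; apply: eq_bigr => n _ /=; ring. Qed.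

Lemma bilateral_sumZ x (c : K) f M :
  bilateral_sum x (fun s => c * f s) M = c * bilateral_sum x f M.
Proof. by rewrite /bilateral_sum mulr_sumr; apply: eq_bigr => n _ /=; ring. Qed.

Lemma bilateral_sum_sum x (I : Type) (r : seq I) (f : I -> K -> K) M :
  bilateral_sum x (fun s => \sum_(i <- r) f i s) M
  = \sum_(i <- r) bilateral_sum x (f i) M.
Proof.
rewrite /bilateral_sum exchange_big; apply: eq_bigr => n _ /=.
by rewrite !mulr_sumr -big_split.
Qed.

(** Value of the bilateral sum of (s + j)^-(m + 1). *)
Definition pole_value (x : K) (j m : nat) : K := - (x ^+ j * ti_factor m x).

Lemma bilateral_sum_principal_part x p (c : nat -> K) j : `|x| = 1 ->
  bilateral_sum x (fun s => principal_part p c (inv_powers (s + j%:R))) @ \oo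
    --> principal_part p c (pole_value x j).
Proof.
move=> x1; rewrite /principal_part.
have -> : bilateral_sum x
  (fun s => \sum_(m < p) c (p - 1 - m)%N * ((s + j%:R) ^+ m.+1)^-1)
  = fun M => \sum_(m < p) c (p - 1 - m)%N * bilateral_sum x
    (fun s => ((s + j%:R) ^+ m.+1)^-1) M.
  by apply/funext => M; rewrite bilateral_sum_sum; apply: eq_bigr => m _;
    rewrite bilateral_sumZ.
by apply: cvg_sum_seq => m _; apply: cvgM;
  [exact: cvg_cst|exact: bilateral_sum_pole].
Qed.

(** Value of the bilateral sum of 1 / ((s + k)^p1 * (s + l)^p2 * s^q).
    The summands are the polar parts at 0, -k and -l, arranged so that the
    coincidences k = 0, l = 0 and k = l need as few separate expressions as
    possible: by [taylor_coef2_diag] the general formulas for the poles at -k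
    and -l remain right when the other index is 0, and that for the pole at 0
    remains right when k = l. *)
Definition triple_value (x : K) p1 p2 q k l : K :=
  (if (k == 0%N) && (l == 0%N) then pole_value x 0 (p1 + p2 + q - 1) else 0)
+ (if (k == 0%N) && (l != 0%N) then
     principal_part (p1 + q) (taylor_coef p2 l%:R) (pole_value x 0) else 0)
+ (if (l == 0%N) && (k != 0%N) then
     principal_part (p2 + q) (taylor_coef p1 k%:R) (pole_value x 0) else 0)
+ (if (k != 0%N) && (l == k) then
     principal_part (p1 + p2) (taylor_coef q (- k%:R)) (pole_value x k) else 0)
+ (if (k != 0%N) && (l != 0%N) then
     principal_part q (taylor_coef2 p1 p2 k%:R l%:R) (pole_value x 0) else 0)
+ (if (k != 0%N) && (l != k) then
     principal_part p1 (taylor_coef2 p2 q (l%:R - k%:R) (- k%:R))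
       (pole_value x k) else 0)
+ (if (l != 0%N) && (k != l) then
     principal_part p2 (taylor_coef2 p1 q (k%:R - l%:R) (- l%:R))
       (pole_value x l) else 0).

Lemma bilateral_sum_pole_sum2 x f p c j p' c' j' : `|x| = 1 ->
  (forall s, half_integer s -> f s =
     principal_part p c (inv_powers (s + j%:R))
   + principal_part p' c' (inv_powers (s + j'%:R))) ->
  bilateral_sum x f @ \oo --> principal_part p c (pole_value x j)
    + principal_part p' c' (pole_value x j').
Proof.
move=> x1 hf; have -> : bilateral_sum x f = fun M =>
   bilateral_sum x (fun s => principal_part p c (inv_powers (s + j%:R))) M
   + bilateral_sum x (fun s => principal_part p' c' (inv_powers (s + j'%:R))) M.
  by apply/funext => M; rewrite -bilateral_sumD; exact: eq_bilateral_sum.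
by apply: cvgD; exact: bilateral_sum_principal_part.
Qed.

Lemma bilateral_sum_triple x p1 p2 q k l : `|x| = 1 ->
  (0 < p1)%N -> (0 < p2)%N -> (0 < q)%N ->
  bilateral_sum x (fun s => ((s + k%:R) ^+ p1 * (s + l%:R) ^+ p2 * s ^+ q)^-1) @ \oo
    --> triple_value x p1 p2 q k l.
Proof.
move=> x1 h1 h2 hq; rewrite /triple_value.
have nz n : n.+1%:R != 0 :> K by rewrite pnatr_eq0.
case: k l => [|k] [|l] /=; rewrite ?addr0 ?add0r.
- have -> : bilateral_sum x (fun s => ((s + 0) ^+ p1 * (s + 0) ^+ p2 * s ^+ q)^-1)
    = bilateral_sum x (fun s => ((s + 0%:R) ^+ (p1 + p2 + q - 1).+1)^-1).
    apply/funext => M; apply: eq_bilateral_sum => s _.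
    have -> : ((p1 + p2 + q - 1).+1 = p1 + p2 + q)%N by lia.
    by rewrite !addr0 !exprD.
  exact: bilateral_sum_pole.
- apply: bilateral_sum_pole_sum2 => // s hs.
  have s0 := half_integer_neq0 hs; have sl0 := half_integerDn_neq0 l.+1 hs.
  rewrite !addr0 mulrAC -exprD partial_fraction2 //; last by lia.
    congr (_ + _); apply: eq_principal_part => t;
      first by rewrite addrAC subrr add0r.
    rewrite taylor_coef2_diag ?oppr_eq0 //; congr (taylor_coef _ _ _); ring.
  by rewrite -subr_eq0 opprD addrA subrr sub0r oppr_eq0.
- apply: bilateral_sum_pole_sum2 => // s hs.
  have s0 := half_integer_neq0 hs; have sl0 := half_integerDn_neq0 k.+1 hs.
  rewrite !addr0 -mulrA -exprD mulrC partial_fraction2 //; last by lia.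
    congr (_ + _); apply: eq_principal_part => t;
      first by rewrite addrAC subrr add0r.
    rewrite taylor_coef2_diag ?oppr_eq0 //; congr (taylor_coef _ _ _); ring.
  by rewrite -subr_eq0 opprD addrA subrr sub0r oppr_eq0.
have [lk|lk] := eqVneq l.+1 k.+1.
  rewrite ?lk ?eqxx /= ?addr0; apply: bilateral_sum_pole_sum2 => // s hs.
  have s0 := half_integer_neq0 hs; have sl0 := half_integerDn_neq0 k.+1 hs.
  rewrite -exprD partial_fraction2 //; last by lia.
    rewrite addr0; congr (_ + _); apply: eq_principal_part => t;
      first by congr (taylor_coef _ _ _); ring.
    by rewrite taylor_coef2_diag //; congr (taylor_coef _ _ _); ring.
  by rewrite -subr_eq0 addrAC subrr add0r.
rewrite /= add0r.
set F := bilateral_sum x _.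
have -> : F = fun M =>
   bilateral_sum x (fun s => principal_part q (taylor_coef2 p1 p2 k.+1%:R l.+1%:R)
     (inv_powers (s + 0%:R))) M
 + bilateral_sum x
   (fun s => principal_part p1 (taylor_coef2 p2 q (l.+1%:R - k.+1%:R) (- k.+1%:R))
   (inv_powers (s + k.+1%:R))) M
 + bilateral_sum x
   (fun s => principal_part p2 (taylor_coef2 p1 q (k.+1%:R - l.+1%:R) (- l.+1%:R))
   (inv_powers (s + l.+1%:R))) M.
  apply/funext => M; rewrite -!bilateral_sumD; apply: eq_bilateral_sum => s hs.
  have s0 := half_integer_neq0 hs; have sl0 := half_integerDn_neq0 l.+1 hs.
  have sk0 := half_integerDn_neq0 k.+1 hs.
  have lkK : l.+1%:R != k.+1%:R :> K by rewrite eqr_nat.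
  rewrite partial_fraction3 //; try lia.
  - have -> : s + l.+1%:R - (s + k.+1%:R) = l.+1%:R - k.+1%:R by ring.
    have -> : s + k.+1%:R - (s + l.+1%:R) = k.+1%:R - l.+1%:R by ring.
    have -> : s - (s + k.+1%:R) = - k.+1%:R by ring.
    have -> : s - (s + l.+1%:R) = - l.+1%:R by ring.
    have -> : s + k.+1%:R - s = k.+1%:R by ring.
    have -> : s + l.+1%:R - s = l.+1%:R by ring.
    by rewrite addr0 addrC addrA.
  - by rewrite (inj_eq (addrI s)) eq_sym.
  - by rewrite -subr_eq0 addrAC subrr add0r.
  - by rewrite -subr_eq0 addrAC subrr add0r.
by apply: cvgD; first apply: cvgD; exact: bilateral_sum_principal_part.
Qed.

End Residues.

(** * Limits of the Laurent coefficients *)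

Section ResidueSums.
Local Open Scope classical_set_scope.
Variable K : numFieldType.
Hypothesis hnull : harmonic_null K.
Hypothesis hcompl : harmonic_complete K.
Implicit Types (x z w y : K) (f g : K -> K) (p q n m j k l M N t i : nat).

Lemma sum_ord_gt0 N (F : nat -> K) :
  \sum_(k < N) (if k != 0%N :> nat then F k else 0) = \sum_(1 <= k < N) F k.
Proof.
case: N => [|N]; first by rewrite big_ord0 big_geq.
by rewrite big_ord_recl /= add0r big_add1 big_mkord.
Qed.

(** Splits the double sum of [triple_value] into one sum for each of its
    summands. *)
Lemma sum_cases N (c : nat -> nat -> K) A (B C D : nat -> K)
    (E F G : nat -> nat -> K) :
  \sum_(k < N.+1) \sum_(l < N.+1) c k l *
   ((if (k == 0%N :> nat) && (l == 0%N :> nat) then A else 0)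
  + (if (k == 0%N :> nat) && (l != 0%N :> nat) then B l else 0)
  + (if (l == 0%N :> nat) && (k != 0%N :> nat) then C k else 0)
  + (if (k != 0%N :> nat) && (l == k :> nat) then D k else 0)
  + (if (k != 0%N :> nat) && (l != 0%N :> nat) then E k l else 0)
  + (if (k != 0%N :> nat) && (l != k :> nat) then F k l else 0)
  + (if (l != 0%N :> nat) && (k != l :> nat) then G k l else 0)) =
  c 0%N 0%N * A + \sum_(1 <= l < N.+1) c 0%N l * B l
  + \sum_(1 <= k < N.+1) c k 0%N * C k
  + \sum_(1 <= k < N.+1) c k k * D k
  + \sum_(1 <= k < N.+1) \sum_(1 <= l < N.+1) c k l * E k l
  + \sum_(1 <= k < N.+1) \sum_(l < N.+1 | l != k :> nat) c k l * F k l
  + \sum_(1 <= l < N.+1) \sum_(k < N.+1 | k != l :> nat) c k l * G k l.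
Proof.
under eq_bigr => k _ do
  (under eq_bigr => l _ do rewrite !mulrDr; rewrite !big_split /=).
rewrite !big_split /=.
have if0 (b : bool) (u v : K) : u * (if b then v else 0) = if b then u * v else 0.
  by case: b => //; rewrite mulr0.
congr (_ + _ + _ + _ + _ + _ + _).
- rewrite big_ord_recl big_ord_recl /= big1 ?addr0 => [|l _]; last by rewrite mulr0.
  by rewrite big1 ?addr0 // => k _; rewrite big1 // => l _; rewrite mulr0.
- rewrite big_ord_recl /= [X in _ + X]big1 ?addr0 => [|k _].
    by under eq_bigr do rewrite if0;
      rewrite (sum_ord_gt0 N.+1 (fun l => c 0%N l * B l)).
  by rewrite big1 // => l _; rewrite mulr0.
- rewrite -(sum_ord_gt0 N.+1 (fun k => c k 0%N * C k)); apply: eq_bigr => k _.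
  rewrite big_ord_recl /= big1 ?addr0 => [|l _]; last by rewrite mulr0.
  by rewrite if0.
- rewrite -(sum_ord_gt0 N.+1 (fun k => c k k * D k)); apply: eq_bigr => k _.
  rewrite (bigD1 k) //= eqxx andbT big1 ?addr0 ?if0 // => l lk.
  by rewrite if0 (_ : (l == k :> nat) = false) ?andbF //; apply/negbTE.
- rewrite -(sum_ord_gt0 N.+1 (fun k => \sum_(1 <= l < N.+1) c k l * E k l)).
  apply: eq_bigr => k _; case: ifP => _ /=; last by apply: big1 => l _;
    rewrite mulr0.
  rewrite -(sum_ord_gt0 N.+1 (fun l => c k l * E k l)).
  by apply: eq_bigr => l _; rewrite if0.
- rewrite -(sum_ord_gt0 N.+1
    (fun k => \sum_(l < N.+1 | l != k :> nat) c k l * F k l)).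
  apply: eq_bigr => k _; case: ifP => _ /=; last by apply: big1 => l _;
    rewrite mulr0.
  by rewrite [RHS]big_mkcond; apply: eq_bigr => l _; rewrite if0.
rewrite exchange_big /=.
rewrite -(sum_ord_gt0 N.+1
  (fun l => \sum_(k < N.+1 | k != l :> nat) c k l * G k l)).
apply: eq_bigr => l _; case: ifP => _ /=; last by apply: big1 => k _; rewrite mulr0.
by rewrite [RHS]big_mkcond; apply: eq_bigr => k _; rewrite if0.
Qed.

(** The terms l > k give zeta at z, the terms l < k give zeta at z^-1. *)
Lemma sum_shifted_powers N p z k : z != 0 -> (k <= N)%N ->
  \sum_(l < N.+1 | l != k :> nat) z ^+ l / (l%:R - k%:R) ^+ p =
  z ^+ k * (zetan (N - k) p z + (-1) ^+ p * zetan k p z^-1).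
Proof.
move=> z0 kN.
rewrite -(big_mkord (fun l => l != k) (fun l => z ^+ l / (l%:R - k%:R) ^+ p)).
rewrite (big_cat_nat (n := k)) //=; last by rewrite ltnW.
rewrite addrC mulrDr; congr (_ + _).
  rewrite big_mkcond big_ltn //= eqxx add0r /zetan mulr_sumr.
  rewrite -{1}[k.+1]add1n big_addn subSn //.
  rewrite !big_seq; apply: eq_bigr => i; rewrite mem_index_iota => /andP[i0 _].
  rewrite (_ : (i + k != k)%N) ?natrD ?addrK ?exprD; last by lia.
  by ring.
rewrite big_mkcond big_nat_rev add0n /zetan mulrA mulr_sumr [in RHS]big_add1 /=.
rewrite !big_seq; apply: eq_bigr => i; rewrite mem_index_iota => /andP[_ ik].
rewrite (_ : (k - i.+1 != k)%N); last by lia.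
have -> : (k - i.+1)%:R - k%:R = - i.+1%:R :> K by rewrite natrB //; ring.
rewrite [(- i.+1%:R) ^+ _]exprNn invfM -[((-1) ^+ _)^-1]exprVn invrN1 exprB
  ?unitfE //.
by rewrite exprVn; ring.
Qed.

Lemma cvg_sumS (F : nat -> K) (l : K) :
  (fun N => \sum_(1 <= n < N) F n) @ \oo --> l ->
  (fun N => \sum_(1 <= n < N.+1) F n) @ \oo --> l.
Proof. by rewrite -(@cvg_shiftS K (fun N => \sum_(1 <= n < N) F n)). Qed.

(** Where zeta_(N-k) is replaced by its limit the error is O(1 / (N + 1 - k)),
    so that the total error is a [harmonic_convolution]. *)
Lemma cvg_zeta_convolution P Q z y : `|z| = 1 -> `|y| = 1 ->
  (0 < P)%N -> (0 < Q)%N -> (P, z) <> (1%N, 1) -> (Q, y) <> (1%N, 1) ->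
  (fun N => \sum_(1 <= k < N.+1) zetan (N - k) P z / k%:R ^+ Q * y ^+ k)
    @ \oo --> Li P z * Li Q y.
Proof.
move=> z1 y1 P0 Q0 Pz Qy.
have h : (fun N => Li P z * \sum_(1 <= k < N.+1) y ^+ k / k%:R ^+ Q) @ \oo -->
  Li P z * Li Q y.
  by apply: cvgM; [exact: cvg_cst|apply: cvg_sumS; exact: Li_cvg].
apply: (cvg_eq0 h).
have [C C0 hC] := tail_bounded_lim hcompl (Li_tail_bounded z1 P0 Pz).
have hv : (fun N => C * harmonic_convolution K N) @ \oo --> C * 0.
  by apply: cvgM; [exact: cvg_cst|exact: harmonic_convolution_cvg0].
rewrite mulr0 in hv; apply: cvg0_le hv => N N0.
rewrite mulr_sumr -sumrB; apply: (le_trans (ler_norm_sum _ _ _)).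
rewrite /harmonic_convolution mulr_sumr !big_seq.
apply: ler_sum => k; rewrite mem_index_iota => /andP[k0 kN].
have -> : Li P z * (y ^+ k / k%:R ^+ Q) - zetan (N - k) P z / k%:R ^+ Q * y ^+ k
  = (Li P z - zetan (N - k) P z) * (y ^+ k / k%:R ^+ Q) by ring.
have -> : C * (k%:R * (N.+1 - k)%:R)^-1 = C / (N.+1 - k)%:R * k%:R^-1.
  by rewrite invfM; ring.
rewrite normrM; apply: ler_pM => //.
  by rewrite subSn //; exact: hC.
rewrite normrM normrX y1 expr1n mul1r normfV normrX normr_nat.
rewrite lef_pV2 ?posrE ?exprn_gt0 ?ltr0n // -natrX ler_nat.
by rewrite -{1}[k]expn1 leq_pexp2l.
Qed.

Lemma taylor_coefN q (a : K) t :
  taylor_coef q (- a) t = (-1) ^+ q * 'C(q + t - 1, t)%:R / a ^+ (q + t).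
Proof.
have <- : (-1) ^+ t * (-1) ^+ (q + t) = (-1) ^+ q :> K.
  by rewrite -exprD addnCA addnn exprD -mul2n exprM sqrrN expr1n expr1n mulr1.
rewrite /taylor_coef [(- a) ^+ _]exprNn invfM -[((-1) ^+ _)^-1]exprVn invrN1.
by ring.
Qed.

Lemma pole_valueE x j m : pole_value x j m = x ^+ j * pole_value x 0 m.
Proof. by rewrite /pole_value expr0 mul1r mulrN. Qed.

Lemma neq1_addn p z t : (p, z) <> (1%N, 1) -> (0 < p)%N ->
  (p + t, z) <> (1%N, 1 : K).
Proof.
move=> h p0 [pt z1]; apply: h; rewrite z1; congr (_, _); lia.
Qed.

Lemma cvg_principal_part (c : nat -> nat -> K) (l : nat -> K) p (k : nat -> K) :
  (forall t, (t < p)%N -> (fun N => c N t) @ \oo --> l t) ->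
  (fun N => principal_part p (c N) k) @ \oo --> principal_part p l k.
Proof.
move=> h; rewrite /principal_part; apply: cvg_sum_seq => m _.
apply: cvgM; [apply: h|exact: cvg_cst].
by have := ltn_ord m; lia.
Qed.

(** The values at the pole -k differ from those at the pole 0 by the factor x^k
    only, so that all polar parts can be collected at 0. *)
Lemma principal_part_lin (I : Type) (r : seq I) (P : pred I) (a : I -> K)
    (c : I -> nat -> K) x (k : I -> nat) p :
  \sum_(i <- r | P i) a i * principal_part p (c i) (pole_value x (k i)) =
  principal_part p (fun t => \sum_(i <- r | P i) a i * x ^+ k i * c i t)
    (pole_value x 0).
Proof.
rewrite /principal_part; under [RHS]eq_bigr do rewrite mulr_suml.
rewrite exchange_big /=; apply: eq_bigr => i _; rewrite mulr_sumr.
by apply: eq_bigr => m _; rewrite pole_valueE; ring.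
Qed.

(** Taylor coefficient at 0 of the sum over l >= 1 of z^l / (s + l)^p, which is
    the part of the Lerch function that is regular at 0. *)
Definition Li_coef p z t := (-1) ^+ t * 'C(p + t - 1, t)%:R * Li (p + t) z.

Lemma cvg_Li_coef p z t : `|z| = 1 -> (0 < p)%N -> (p, z) <> (1%N, 1) ->
  (fun N => \sum_(1 <= l < N.+1) z ^+ l * taylor_coef p l%:R t) @ \oo -->
    Li_coef p z t.
Proof.
move=> z1 p0 pz; rewrite /Li_coef.
have -> : (fun N => \sum_(1 <= l < N.+1) z ^+ l * taylor_coef p l%:R t) = fun N =>
   (-1) ^+ t * 'C(p + t - 1, t)%:R * \sum_(1 <= l < N.+1) z ^+ l / l%:R ^+ (p + t).
  by apply/funext => N; rewrite mulr_sumr; apply: eq_bigr => l _;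
    rewrite /taylor_coef; ring.
apply: cvgM; first exact: cvg_cst.
by apply: cvg_sumS; apply: Li_cvg => //; [rewrite ltn_addr|exact: neq1_addn].
Qed.

Lemma cvg_LiN_coef q z t : `|z| = 1 -> (0 < q)%N -> (q, z) <> (1%N, 1) ->
  (fun N => \sum_(1 <= k < N.+1) z ^+ k * taylor_coef q (- k%:R) t) @ \oo -->
  (-1) ^+ q * 'C(q + t - 1, t)%:R * Li (q + t) z.
Proof.
move=> z1 p0 pz.
have -> : (fun N => \sum_(1 <= k < N.+1) z ^+ k * taylor_coef q (- k%:R) t)
  = fun N =>
   (-1) ^+ q * 'C(q + t - 1, t)%:R * \sum_(1 <= l < N.+1) z ^+ l / l%:R ^+ (q + t).
  by apply/funext => N; rewrite mulr_sumr; apply: eq_bigr => l _;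
    rewrite taylor_coefN; ring.
apply: cvgM; first exact: cvg_cst.
by apply: cvg_sumS; apply: Li_cvg => //; [rewrite ltn_addr|exact: neq1_addn].
Qed.

(** Limit of the coefficients of the polar parts at -1, -2, ... arising from
    one Lerch function: the other one is expanded there together with s^-q, its
    terms before and after the pole giving S and Li. *)
Definition S_coef p q z y t :=
  \sum_(i < t.+1) (-1) ^+ q * 'C(p + i - 1, i)%:R * 'C(q + (t - i) - 1, t - i)%:R
   * ((-1) ^+ i * Li (p + i) z * Li (q + (t - i)) y
      + (-1) ^+ p * Slin (p + i) (q + (t - i)) z^-1 y).

Lemma cvg_S_coef p q z y t : `|z| = 1 -> `|y| = 1 -> (0 < p)%N -> (0 < q)%N ->
  (p, z) <> (1%N, 1) -> (q, y * z) <> (1%N, 1) ->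
  (fun N => \sum_(1 <= k < N.+1) \sum_(l < N.+1 | l != k :> nat)
     y ^+ k * z ^+ l * taylor_coef2 p q (l%:R - k%:R) (- k%:R) t) @ \oo -->
  S_coef p q z (y * z) t.
Proof.
move=> z1 y1 p0 q0 pz qy; have z0 : z != 0 by rewrite -normr_eq0 z1 oner_eq0.
have yz1 : `|y * z| = 1 by rewrite normrM y1 z1 mul1r.
have -> : (fun N => \sum_(1 <= k < N.+1) \sum_(l < N.+1 | l != k :> nat)
     y ^+ k * z ^+ l * taylor_coef2 p q (l%:R - k%:R) (- k%:R) t) = fun N =>
   \sum_(i < t.+1) (-1) ^+ q * 'C(p + i - 1, i)%:R * 'C(q + (t - i) - 1, t - i)%:R
    * ((-1) ^+ i * (\sum_(1 <= k < N.+1)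
            zetan (N - k) (p + i) z / k%:R ^+ (q + (t - i)) * (y * z) ^+ k)
       + (-1) ^+ p * \sum_(1 <= k < N.+1)
            zetan k (p + i) z^-1 / k%:R ^+ (q + (t - i)) * (y * z) ^+ k).
  apply/funext => N.
  transitivity (\sum_(1 <= k < N.+1) \sum_(i < t.+1)
     y ^+ k * (-1) ^+ i * 'C(p + i - 1, i)%:R * taylor_coef q (- k%:R) (t - i)
     * (\sum_(l < N.+1 | l != k :> nat) z ^+ l / (l%:R - k%:R) ^+ (p + i))).
    apply: eq_bigr => k _; under eq_bigr do rewrite /taylor_coef2 mulr_sumr.
    rewrite exchange_big /=; apply: eq_bigr => i _; rewrite mulr_sumr.
    by apply: eq_bigr => l _; rewrite /taylor_coef; ring.
  rewrite exchange_big /=; apply: eq_bigr => i _.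
  rewrite mulrDr !mulr_sumr -big_split /= !big_seq; apply: eq_bigr => k.
  rewrite mem_index_iota => /andP[k0 kN];
    rewrite sum_shifted_powers // taylor_coefN.
  have e : (-1) ^+ p = (-1) ^+ i * (-1) ^+ (p + i) :> K.
    by rewrite -exprD addnCA addnn exprD -mul2n exprM sqrrN expr1n expr1n mulr1.
  by rewrite [in RHS]e exprMn; ring.
rewrite /S_coef; apply: cvg_sum_seq => i _; apply: cvgM; first exact: cvg_cst.
have pi0 : (0 < p + i)%N by rewrite ltn_addr.
have qi0 : (0 < q + (t - i))%N by rewrite ltn_addr.
have pzi : ((p + i)%N, z) <> (1%N, 1) by exact: neq1_addn.
have qyi : ((q + (t - i))%N, y * z) <> (1%N, 1) by exact: neq1_addn.
apply: cvgD.
  rewrite -mulrA; apply: cvgM; first exact: cvg_cst.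
  exact: cvg_zeta_convolution.
apply: cvgM; first exact: cvg_cst.
apply: cvg_sumS.
by apply: Slin_cvg => //; [exact: norm_inv1|exact: pair_neq1V].
Qed.

End ResidueSums.

(** * Summing the kernel over its poles *)

Section PoleSide.
Local Open Scope classical_set_scope.
Variable K : numFieldType.
Hypothesis hnull : harmonic_null K.
Hypothesis hcompl : harmonic_complete K.
Implicit Types (x z w y : K) (f g : K -> K) (p q n m j k l M N t i : nat).

Definition residue_sum x x1 x2 p1 p2 q N :=
  \sum_(k < N) \sum_(l < N) x1 ^+ k * x2 ^+ l * triple_value x p1 p2 q k l.

(** The bilateral sum of the kernel in terms of Li and S.  The first term is the
    pole of order p1 + p2 + q at 0 formed by the initial terms of both Lerch
    functions, the next two are poles at 0 with one initial term, and the fifth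
    is the pole s^-q with none.  The fourth collects the poles of order p1 + p2
    at -1, -2, ..., the last two those of the single Lerch functions. *)
Definition residue_limit x x1 x2 p1 p2 q : K :=
  let k0 := pole_value x 0 in
  k0 (p1 + p2 + q - 1)%N
  + principal_part (p1 + q) (Li_coef p2 x2) k0
  + principal_part (p2 + q) (Li_coef p1 x1) k0
  + principal_part (p1 + p2) (fun t => (-1) ^+ q * 'C(q + t - 1, t)%:R
                               * Li (q + t) (x * x1 * x2)) k0
  + principal_part q
    (fun t => \sum_(i < t.+1) Li_coef p1 x1 i * Li_coef p2 x2 (t - i)) k0
  + principal_part p1 (S_coef p2 q x2 (x * x1 * x2)) k0
  + principal_part p2 (S_coef p1 q x1 (x * x2 * x1)) k0.

Lemma principal_part_lin0 (I : Type) (r : seq I) (P : pred I) (a : I -> K)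
    (c : I -> nat -> K) x p :
  \sum_(i <- r | P i) a i * principal_part p (c i) (pole_value x 0) =
  principal_part p (fun t => \sum_(i <- r | P i) a i * c i t) (pole_value x 0).
Proof.
rewrite (principal_part_lin r P a c x (fun=> 0%N)); apply: eq_principal_part => t.
by apply: eq_bigr => i _; rewrite expr0 mulr1.
Qed.

Lemma residue_sum_cvg x x1 x2 p1 p2 q :
  `|x| = 1 -> `|x1| = 1 -> `|x2| = 1 ->
  (0 < p1)%N -> (0 < p2)%N -> (0 < q)%N ->
  (p1, x1) <> (1%N, 1) -> (p2, x2) <> (1%N, 1) ->
  (q, x * x1 * x2) <> (1%N, 1) ->
  (fun N => residue_sum x x1 x2 p1 p2 q N.+1) @ \oo -->
    residue_limit x x1 x2 p1 p2 q.
Proof.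
move=> nx nx1 nx2 hp1 hp2 hq px1 px2 qx.
have nx12 : `|x * x1 * x2| = 1 by rewrite !normrM nx nx1 nx2 !mulr1.
pose k0 := pole_value x 0.
have -> : (fun N => residue_sum x x1 x2 p1 p2 q N.+1) = fun N =>
  k0 (p1 + p2 + q - 1)%N
  + principal_part (p1 + q)
    (fun t => \sum_(1 <= l < N.+1) x2 ^+ l * taylor_coef p2 l%:R t) k0
  + principal_part (p2 + q)
    (fun t => \sum_(1 <= k < N.+1) x1 ^+ k * taylor_coef p1 k%:R t) k0
  + principal_part (p1 + p2) (fun t => \sum_(1 <= k < N.+1)
       (x * x1 * x2) ^+ k * taylor_coef q (- k%:R) t) k0
  + principal_part q (fun t => \sum_(i < t.+1)
       (\sum_(1 <= k < N.+1) x1 ^+ k * taylor_coef p1 k%:R i) *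
       (\sum_(1 <= l < N.+1) x2 ^+ l * taylor_coef p2 l%:R (t - i))) k0
  + principal_part p1 (fun t => \sum_(1 <= k < N.+1) \sum_(l < N.+1 | l != k :> nat)
     (x * x1) ^+ k * x2 ^+ l * taylor_coef2 p2 q (l%:R - k%:R) (- k%:R) t) k0
  + principal_part p2 (fun t => \sum_(1 <= l < N.+1) \sum_(k < N.+1 | k != l :> nat)
     (x * x2) ^+ l * x1 ^+ k * taylor_coef2 p1 q (k%:R - l%:R) (- l%:R) t) k0.
  apply/funext => N; rewrite /residue_sum /triple_value.
  rewrite [LHS](sum_cases N (fun k l => x1 ^+ k * x2 ^+ l) (k0 _)
    (fun l => principal_part (p1 + q) (taylor_coef p2 l%:R) k0)
    (fun k => principal_part (p2 + q) (taylor_coef p1 k%:R) k0)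
    (fun k => principal_part (p1 + p2) (taylor_coef q (- k%:R)) (pole_value x k))
    (fun k l => principal_part q (taylor_coef2 p1 p2 k%:R l%:R) k0)
    (fun k l => principal_part p1 (taylor_coef2 p2 q (l%:R - k%:R) (- k%:R))
      (pole_value x k))
    (fun k l => principal_part p2 (taylor_coef2 p1 q (k%:R - l%:R) (- l%:R))
      (pole_value x l))).
  congr (_ + _ + _ + _ + _ + _ + _).
  - by rewrite !expr0 !mul1r.
  - by rewrite principal_part_lin0; apply: eq_principal_part => t;
      apply: eq_bigr => l _; rewrite expr0 mul1r.
  - by rewrite principal_part_lin0; apply: eq_principal_part => t;
      apply: eq_bigr => l _; rewrite expr0 mulr1.
  - rewrite (principal_part_lin _ _ _ _ _ id); apply: eq_principal_part => t;
      apply: eq_bigr => k _.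
    by rewrite !exprMn; ring.
  - under eq_bigr do rewrite principal_part_lin0.
    transitivity (\sum_(1 <= k < N.+1) 1 * principal_part q
      (fun t => \sum_(1 <= l < N.+1)
       x1 ^+ k * x2 ^+ l * taylor_coef2 p1 p2 k%:R l%:R t) k0).
      by apply: eq_bigr => k _; rewrite mul1r.
    rewrite principal_part_lin0; apply: eq_principal_part => t.
    transitivity (\sum_(1 <= k < N.+1) \sum_(1 <= l < N.+1) \sum_(i < t.+1)
      x1 ^+ k * taylor_coef p1 k%:R i * (x2 ^+ l * taylor_coef p2 l%:R (t - i))).
      apply: eq_bigr => k _; rewrite mul1r; apply: eq_bigr => l _.
      by rewrite /taylor_coef2 mulr_sumr; apply: eq_bigr => i _; ring.
    under eq_bigr do rewrite exchange_big /=.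
    rewrite exchange_big /=; apply: eq_bigr => i _; rewrite mulr_suml.
    by apply: eq_bigr => k _; rewrite mulr_sumr.
  - under eq_bigr => k _ do rewrite (principal_part_lin _ _ _ _ _ (fun=> k)).
    transitivity (\sum_(1 <= k < N.+1) 1 * principal_part p1
      (fun t => \sum_(l < N.+1 | l != k :> nat)
       x1 ^+ k * x2 ^+ l * x ^+ k * taylor_coef2 p2 q (l%:R - k%:R) (- k%:R) t) k0).
      by apply: eq_bigr => k _; rewrite mul1r.
    rewrite principal_part_lin0; apply: eq_principal_part => t;
      apply: eq_bigr => k _.
    by rewrite mul1r; apply: eq_bigr => l _; rewrite exprMn; ring.
  - under eq_bigr => l _ do rewrite (principal_part_lin _ _ _ _ _ (fun=> l)).
    transitivity (\sum_(1 <= l < N.+1) 1 * principal_part p2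
      (fun t => \sum_(k < N.+1 | k != l :> nat)
       x1 ^+ k * x2 ^+ l * x ^+ l * taylor_coef2 p1 q (k%:R - l%:R) (- l%:R) t) k0).
      by apply: eq_bigr => k _; rewrite mul1r.
    rewrite principal_part_lin0; apply: eq_principal_part => t;
      apply: eq_bigr => l _.
    by rewrite mul1r; apply: eq_bigr => k _; rewrite exprMn; ring.
rewrite /residue_limit -/k0.
apply: cvgD; last first.
  apply: cvg_principal_part => t _; apply: cvg_S_coef => //;
    first by rewrite normrM nx nx2 mul1r.
  by rewrite mulrAC.
apply: cvgD; last first.
  by apply: cvg_principal_part => t _; apply: cvg_S_coef => //;
    rewrite normrM nx nx1 mul1r.
apply: cvgD; last first.
  apply: cvg_principal_part => t _; apply: cvg_sum_seq => i _.
  by apply: cvgM; exact: cvg_Li_coef.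
apply: cvgD; last by apply: cvg_principal_part => t _; exact: cvg_LiN_coef.
apply: cvgD; last by apply: cvg_principal_part => t _; exact: cvg_Li_coef.
apply: cvgD; last by apply: cvg_principal_part => t _; exact: cvg_Li_coef.
exact: cvg_cst.
Qed.

(** Lerch function cut at k < N. *)
Definition lerch_partial N p z (s : K) : K := \sum_(k < N) z ^+ k / (s + k%:R) ^+ p.

(** The truncated kernel is a finite sum of the functions treated in
    [bilateral_sum_triple]. *)
Lemma bilateral_sum_kernel_cvg x x1 x2 p1 p2 q N : `|x| = 1 ->
  (0 < p1)%N -> (0 < p2)%N -> (0 < q)%N ->
  bilateral_sum x (fun s => lerch_partial N p1 x1 s
    * lerch_partial N p2 x2 s / s ^+ q)
    @ \oo --> residue_sum x x1 x2 p1 p2 q N.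
Proof.
move=> nx hp1 hp2 hq; rewrite /residue_sum.
have -> : bilateral_sum x
  (fun s => lerch_partial N p1 x1 s * lerch_partial N p2 x2 s / s ^+ q)
  = fun M => \sum_(k < N) \sum_(l < N) x1 ^+ k * x2 ^+ l *
     bilateral_sum x (fun s => ((s + k%:R) ^+ p1 * (s + l%:R) ^+ p2 * s ^+ q)^-1) M.
  apply/funext => M.
  under eq_bigr => k _ do under eq_bigr => l _ do rewrite -bilateral_sumZ.
  under eq_bigr => k _ do rewrite -bilateral_sum_sum.
  rewrite -bilateral_sum_sum; apply: eq_bilateral_sum => s _.
  rewrite /lerch_partial mulr_suml mulr_suml; apply: eq_bigr => k _.
  rewrite mulr_sumr mulr_suml; apply: eq_bigr => l _.
  by rewrite !invfM; ring.
apply: cvg_sum_seq => k _; apply: cvg_sum_seq => l _.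
by apply: cvgM; [exact: cvg_cst|exact: bilateral_sum_triple].
Qed.

End PoleSide.

(** * Summing the kernel over the half-integers *)

Section HalfIntegerSide.
Local Open Scope classical_set_scope.
Variable K : numFieldType.
Hypothesis hnull : harmonic_null K.
Hypothesis hcompl : harmonic_complete K.
Implicit Types (x z w y : K) (f g : K -> K) (p q n m j k l M N t i : nat).

(** Value of the Lerch function at n - 1/2. *)
Definition lerch_pos p z n : K := z^-1 ^+ n * (ti p z - tn n.-1 p z).

(** Value of the Lerch function at 1/2 - m. *)
Definition lerch_neg p z m : K :=
  (-1) ^+ p * z ^+ m * (tn m p z^-1 + (-1) ^+ p * z^-1 * ti p z).

Lemma lerch_partial_pos N p z n : z != 0 ->
  lerch_partial N p z (n%:R - 2^-1)
  = z^-1 ^+ n * \sum_(n <= i < N + n) z ^+ i / (i%:R - 2^-1) ^+ p.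
Proof.
move=> z0; rewrite -[X in \sum_(X <= _ < _) _]add0n big_addn addnK.
rewrite big_mkord mulr_sumr.
apply: eq_bigr => k _; rewrite natrD exprD exprVn.
have -> : n%:R - 2^-1 + k%:R = k%:R + n%:R - 2^-1 :> K by ring.
by rewrite [z ^+ k * z ^+ n]mulrC -(mulrA (z ^+ n)) mulKf // expf_neq0.
Qed.

(** Substituting i = m - k for the terms to the left of the half-integer. *)
Lemma backward_sum p z m j : z != 0 -> (j <= m)%N ->
  \sum_(k < j) z ^+ k / (- (m%:R - 2^-1) + k%:R) ^+ p =
  (-1) ^+ p * z ^+ m * \sum_((m - j).+1 <= i < m.+1) z^-1 ^+ i / (i%:R - 2^-1) ^+ p.
Proof.
move=> z0 jm.
rewrite -(big_mkord predT (fun k => z ^+ k / (- (m%:R - 2^-1) + k%:R) ^+ p)).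
have -> : ((m - j).+1 = 1 + (m - j))%N by rewrite add1n.
rewrite big_addn (_ : (m.+1 - (m - j) = j.+1)%N); last by lia.
rewrite big_nat_rev [in RHS]big_add1 /= mulr_sumr !big_seq; apply: eq_bigr => i.
rewrite mem_index_iota => /andP[_ ij]; rewrite add0n.
have -> : - (m%:R - 2^-1) + (j - i.+1)%:R = - ((i.+1 + (m - j))%:R - 2^-1) :> K.
  by rewrite natrD !natrB //; ring.
rewrite [(- (_ - _)) ^+ _]exprNn invfM -[((-1) ^+ _)^-1]exprVn invrN1 addSn.
have -> : (j - i.+1 = m - (i + (m - j)).+1)%N by lia.
rewrite expfB_cond ?(negPf z0) /=; last by lia.
by rewrite exprVn; ring.
Qed.

Lemma lerch_partial_neg N p z m : z != 0 -> (0 < m <= N)%N ->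
  lerch_partial N p z (- (m%:R - 2^-1)) =
  (-1) ^+ p * z ^+ m * (tn m p z^-1 + (-1) ^+ p * z^-1 * tn (N - m) p z).
Proof.
move=> z0 /andP[m0 mN]; rewrite /lerch_partial.
rewrite -(big_mkord predT (fun k => z ^+ k / (- (m%:R - 2^-1) + k%:R) ^+ p)).
rewrite (big_cat_nat (n := m)) //= big_mkord backward_sum // subnn.
rewrite [RHS]mulrDr; congr (_ + _).
rewrite -{1}[m]add0n big_addn /tn big_add1 /= !mulr_sumr; apply: eq_bigr => i _.
have -> : - (m%:R - 2^-1) + (i + m)%:R = i.+1%:R - 2^-1 :> K.
  by rewrite natrD -natr1; field.
have e : (-1) ^+ p * (-1) ^+ p = 1 :> K by rewrite -exprMn mulrNN mulr1 expr1n.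
transitivity ((-1) ^+ p * (-1) ^+ p * (z ^+ m * (z^-1 * z ^+ i.+1)) /
  (i.+1%:R - 2^-1) ^+ p); last by ring.
by rewrite e mul1r exprS mulKf // -exprD addnC.
Qed.

Lemma lerch_partial_far N p z m : z != 0 -> (N <= m)%N ->
  lerch_partial N p z (- (m%:R - 2^-1)) =
  (-1) ^+ p * z ^+ m * \sum_((m - N).+1 <= i < m.+1) z^-1 ^+ i / (i%:R - 2^-1) ^+ p.
Proof. exact: backward_sum. Qed.

(** All estimates on the Lerch function and its truncations, with one constant:
    sizes at both kinds of half-integers, distances to the limits for indices
    at most N, and decay at 1/2 - n for n > N, where all N denominators are
    negative and of size at least n - N. *)
Record lerch_bounds (p : nat) (z : K) (C : K) : Prop := LerchBounds {
  lb_ge0 : 0 <= C;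
  lb_pos : forall n, (0 < n)%N -> `|lerch_pos p z n| <= C / n%:R;
  lb_neg : forall n, (0 < n)%N -> `|lerch_neg p z n| <= C;
  lb_partial_pos : forall N n, (0 < n)%N ->
    `|lerch_partial N p z (n%:R - 2^-1)| <= C / n%:R;
  lb_partial_neg : forall N n, (0 < n <= N)%N ->
    `|lerch_partial N p z (- (n%:R - 2^-1))| <= C;
  lb_dist_pos : forall N n, (0 < n <= N)%N ->
    `|lerch_partial N p z (n%:R - 2^-1) - lerch_pos p z n| <= C / (N.+1 - n)%:R;
  lb_dist_neg : forall N n, (0 < n <= N)%N ->
    `|lerch_partial N p z (- (n%:R - 2^-1)) - lerch_neg p z n| <= C / (N.+1 - n)%:R;
  lb_far : forall N n, (N < n)%N ->
    `|lerch_partial N p z (- (n%:R - 2^-1))| <= C / (n - N)%:R }.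

Lemma ler_div_nat (C D : K) a b : 0 <= C -> C <= D -> (0 < a <= b)%N ->
  C / b%:R <= D / a%:R.
Proof.
move=> C0 CD /andP[a0 ab]; apply: ler_pM; rewrite ?invr_ge0 ?ler0n //.
by rewrite lef_pV2 ?posrE ?ltr0n ?ler_nat //; apply: leq_trans ab.
Qed.

Lemma ge_div_nat (C : K) n : 0 <= C -> (0 < n)%N -> C / n%:R <= C.
Proof. by move=> C0 n0; rewrite ler_piMr // invf_le1 ?ltr0n // ler1n. Qed.

Lemma lerch_bounds_ex p z : `|z| = 1 -> (0 < p)%N -> (p, z) <> (1%N, 1) ->
  exists C, lerch_bounds p z C.
Proof.
move=> z1 p0 pz; have z0 : z != 0 by rewrite -normr_eq0 z1 oner_eq0.
have zV1 := norm_inv1 z1; have pzV := pair_neq1V pz.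
have tb := polylog_tail_bounded (half_shift K) z1 p0 pz.
have tbV := polylog_tail_bounded (half_shift K) zV1 p0 pzV.
have [C1 C10 hC1] := tb; have [C2 C20 hC2] := tbV.
have [C3 C30 hC3] := tail_bounded_lim hcompl tb.
have n1X (s : K) n : `|s| = 1 -> `|s ^+ n| = 1.
  by move=> s1; rewrite normrX s1 expr1n.
have n1N n : `|(-1) ^+ n : K| = 1 by apply: n1X; rewrite normrN1.
have tnb n : `|tn n p z^-1| <= C2 by have := hC2 1%N n.+1 isT; rewrite divr1.
have tnb1 n : `|tn n p z| <= C1 by have := hC1 1%N n.+1 isT; rewrite divr1.
have tib : `|ti p z| <= C3.
  by have := hC3 1%N isT; rewrite [X in _ - X]big_geq // subr0 divr1.
have tit n : `|ti p z - tn n p z| <= C3 / n.+1%:R by exact: hC3.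
pose C := C1 + C2 + C3.
have CC1 : C1 <= C by rewrite /C -addrA lerDl addr_ge0.
have CC3 : C3 <= C by rewrite /C lerDr addr_ge0.
have CC2 : C2 <= C by rewrite /C -addrA addrCA lerDl addr_ge0.
have CC23 : C2 + C3 <= C by rewrite /C -addrA lerDr.
have CC12 : C2 + C1 <= C by rewrite /C [C1 + _]addrC lerDl.
have C0 : 0 <= C by apply: le_trans CC1.
exists C; split => //.
- move=> [//|n] _; rewrite /lerch_pos normrM n1X // mul1r /=.
  by apply: le_trans (tit n) _; apply: ler_div_nat => //; rewrite /= leqnn.
- move=> n _; rewrite /lerch_neg !normrM n1N n1X // !mul1r; apply: le_trans CC23.
  apply: (le_trans (ler_normD _ _)); apply: lerD => //.
  by rewrite !normrM n1N zV1 !mul1r.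
- move=> N n n0; rewrite lerch_partial_pos // normrM n1X // mul1r.
  apply: le_trans (hC1 _ _ _) _; first by rewrite n0 leq_addl.
  by apply: ler_div_nat => //; rewrite n0 /=.
- move=> N n nN; rewrite lerch_partial_neg // !normrM n1N n1X // !mul1r.
  apply: le_trans CC12; apply: (le_trans (ler_normD _ _)); apply: lerD => //.
  by rewrite !normrM n1N zV1 !mul1r.
- move=> N [//|n] nN;
    rewrite lerch_partial_pos // /lerch_pos -mulrBr normrM n1X // mul1r /=.
  have -> : \sum_(n.+1 <= i < N + n.+1) z ^+ i / (i%:R - 2^-1) ^+ p
     = tn (N + n) p z - tn n p z.
    rewrite /tn (big_cat_nat (n := n.+1) (p := (N + n).+1)) //=; last by clear; lia.
    by rewrite addrAC subrr add0r addnS.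
  have -> : tn (N + n) p z - tn n p z - (ti p z - tn n p z)
    = - (ti p z - tn (N + n) p z) by ring.
  rewrite normrN; apply: le_trans (tit _) _; apply: ler_div_nat => //.
  by clear -nN; lia.
- move=> N n nN; rewrite lerch_partial_neg // /lerch_neg -mulrBr !normrM n1N n1X
    // !mul1r.
  rewrite opprD addrACA subrr add0r -mulrBr !normrM n1N zV1 !mul1r distrC.
  by apply: le_trans (tit _) _; apply: ler_div_nat => //; clear -nN; lia.
- move=> N n nN; rewrite lerch_partial_far; [|by []|exact: ltnW].
  rewrite !normrM n1N n1X // !mul1r.
  apply: le_trans (hC2 _ _ _) _; first by clear; lia.
  by apply: ler_div_nat => //; clear -nN; lia.
Qed.

(** Contribution of the half-integers n - 1/2 and 1/2 - n to the bilateral sum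
    of the untruncated kernel. *)
Definition kernel_term x x1 x2 p1 p2 q n : K :=
  x * x^-1 ^+ n * (lerch_pos p1 x1 n * lerch_pos p2 x2 n / (n%:R - 2^-1) ^+ q)
  + x ^+ n * (lerch_neg p1 x1 n * lerch_neg p2 x2 n / (- (n%:R - 2^-1)) ^+ q).

Lemma norm_prod_diff (a b c d e A B : K) : `|a| <= A -> `|b - d| <= B * e ->
  `|d| <= B -> `|a - c| <= A * e ->
  `|a * b - c * d| <= A * B * e *+ 2.
Proof.
move=> ha hb hd hac.
have -> : a * b - c * d = a * (b - d) + (a - c) * d by ring.
apply: (le_trans (ler_normD _ _)); rewrite !normrM.
have -> : A * B * e *+ 2 = A * (B * e) + A * e * B by ring.
by apply: lerD; apply: ler_pM.
Qed.

Lemma half_int_invX_le q n : (0 < n)%N -> (0 < q)%N ->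
  `|((n%:R - 2^-1) ^+ q)^-1 : K| <= 2 ^+ q / n%:R
  /\ `|((- (n%:R - 2^-1)) ^+ q)^-1 : K| <= 2 ^+ q / n%:R.
Proof.
move=> n0 q0; have h := inv_shiftX_le (half_shift K) n0 q0; split=> //.
rewrite [(- (_ - _)) ^+ _]exprNn invfM normrM -[((-1) ^+ _)^-1]exprVn invrN1.
by rewrite normrX normrN1 expr1n mul1r.
Qed.

(** For n <= N the terms differ by O(1 / (n * (N + 1 - n))).  For n > N there is
    nothing to compare with, but the truncated terms are O(1 / (N * (n - N)^2)).
    The bound is uniform in M, which lets M tend to infinity first. *)
Lemma bilateral_sum_kernel_bound x x1 x2 p1 p2 q :
  `|x| = 1 -> `|x1| = 1 -> `|x2| = 1 ->
  (0 < p1)%N -> (0 < p2)%N -> (0 < q)%N ->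
  (p1, x1) <> (1%N, 1) -> (p2, x2) <> (1%N, 1) ->
  exists C : K, forall N M, (0 < N < M)%N ->
  `|bilateral_sum x
    (fun s => lerch_partial N p1 x1 s * lerch_partial N p2 x2 s / s ^+ q) M
    - \sum_(1 <= n < N.+1) kernel_term x x1 x2 p1 p2 q n|
  <= C * (harmonic_convolution K N + N%:R^-1).
Proof.
move=> nx nx1 nx2 hp1 hp2 hq px1 px2.
have [C1 [C10 f1 b1 pf1 pb1 df1 db1 far1]] := lerch_bounds_ex nx1 hp1 px1.
have [C2 [C20 f2 b2 pf2 pb2 df2 db2 far2]] := lerch_bounds_ex nx2 hp2 px2.
(* one factor 2 for the two half-integers of each index, one for the two
   differences in a product; 2^q bounds n^q / (n - 1/2)^q *)
pose D := C1 * C2 * 2 ^+ q *+ 4.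
have D0 : 0 <= D by rewrite mulrn_wge0 // !mulr_ge0 ?exprn_ge0 ?ler0n.
have xn n : `|x ^+ n| = 1 by rewrite normrX nx expr1n.
have xVn n : `|x * x^-1 ^+ n| = 1.
  by rewrite normrM normrX norm_inv1 // expr1n nx mulr1.
exists D => N M /andP[N0 NM].
pose L s := lerch_partial N p1 x1 s * lerch_partial N p2 x2 s.
pose G s := L s / s ^+ q.
pose T n := x * x^-1 ^+ n * G (n%:R - 2^-1) + x ^+ n * G (- (n%:R - 2^-1)).
have near n : (0 < n <= N)%N ->
    `|T n - kernel_term x x1 x2 p1 p2 q n| <= D * (n%:R * (N.+1 - n)%:R)^-1.
  move=> nN; have [n0 nN'] := andP nN.
  have [i1 i2] := half_int_invX_le n0 hq.
  set e : K := (N.+1 - n)%:R^-1.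
  have e0 : 0 <= e by rewrite invr_ge0 ler0n.
  have hf : `|L (n%:R - 2^-1) - lerch_pos p1 x1 n * lerch_pos p2 x2 n|
      <= C1 * C2 * e *+ 2.
    apply: norm_prod_diff; [|exact: df2| |exact: df1].
      by apply: le_trans (pf1 N n n0) _; exact: ge_div_nat.
    by apply: le_trans (f2 n n0) _; exact: ge_div_nat.
  have hb : `|L (- (n%:R - 2^-1)) - lerch_neg p1 x1 n * lerch_neg p2 x2 n|
      <= C1 * C2 * e *+ 2.
    by apply: norm_prod_diff; [exact: pb1|exact: db2|exact: b2|exact: db1].
  have -> : T n - kernel_term x x1 x2 p1 p2 q n =
     x * x^-1 ^+ n * ((L (n%:R - 2^-1) - lerch_pos p1 x1 n * lerch_pos p2 x2 n) /
       (n%:R - 2^-1) ^+ q)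
   + x ^+ n * ((L (- (n%:R - 2^-1)) - lerch_neg p1 x1 n * lerch_neg p2 x2 n) /
     (- (n%:R - 2^-1)) ^+ q).
    by rewrite /T /G /kernel_term; ring.
  apply: (le_trans (ler_normD _ _)).
  have -> : D * (n%:R * (N.+1 - n)%:R)^-1 = C1 * C2 * e *+ 2 * (2 ^+ q / n%:R)
    + C1 * C2 * e *+ 2 * (2 ^+ q / n%:R).
    by rewrite invfM -/e /D; ring.
  rewrite [`|x * x^-1 ^+ n * _|]normrM xVn mul1r [`|x ^+ n * _|]normrM xn mul1r.
  by rewrite !normrM; apply: lerD; apply: ler_pM.
have far n : (N < n)%N -> `|T n| <= D / N%:R / 2 * ((n - N)%:R ^+ 2)^-1.
  move=> Nn; have n0 : (0 < n)%N by apply: leq_trans Nn.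
  have [i1 i2] := half_int_invX_le n0 hq.
  have nN0 : (0 < n - N)%N by rewrite subn_gt0.
  have g1 : `|lerch_partial N p1 x1 (n%:R - 2^-1)| <= C1 / (n - N)%:R.
    by apply: le_trans (pf1 N n n0) _; apply: ler_div_nat => //; clear -Nn; lia.
  have g2 : `|lerch_partial N p2 x2 (n%:R - 2^-1)| <= C2 / (n - N)%:R.
    by apply: le_trans (pf2 N n n0) _; apply: ler_div_nat => //; clear -Nn; lia.
  have h1 := far1 N n Nn; have h2 := far2 N n Nn.
  have j : 2 ^+ q / n%:R <= 2 ^+ q / N%:R :> K.
    by apply: ler_div_nat; rewrite ?exprn_ge0 ?ler0n // N0 ltnW.
  apply: (le_trans (ler_normD _ _)).
  have -> : D / N%:R / 2 * ((n - N)%:R ^+ 2)^-1 =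
    C1 / (n - N)%:R * (C2 / (n - N)%:R) * (2 ^+ q / N%:R)
    + C1 / (n - N)%:R * (C2 / (n - N)%:R) * (2 ^+ q / N%:R).
    by rewrite /D; field; rewrite !pnatr_eq0 -!lt0n N0.
  rewrite [`|x * x^-1 ^+ n * _|]normrM xVn mul1r.
  rewrite [`|x ^+ n * _|]normrM xn mul1r /G /L.
  rewrite !normrM; apply: lerD; apply: ler_pM => //; rewrite ?mulr_ge0 //.
  - by apply: ler_pM.
  - exact: le_trans i1 j.
  - by apply: ler_pM.
  - exact: le_trans i2 j.
rewrite /bilateral_sum -/(T _) (big_cat_nat (n := N.+1)) //= addrAC -sumrB mulrDr.
apply: (le_trans (ler_normD _ _)); apply: lerD.
  apply: (le_trans (ler_norm_sum _ _ _)).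
  rewrite /harmonic_convolution mulr_sumr !big_seq; apply: ler_sum => n.
  by rewrite mem_index_iota => nN; apply: near; lia.
apply: (le_trans (ler_norm_sum _ _ _)).
apply: le_trans (_ : \sum_(N.+1 <= n < M) D / N%:R / 2 * ((n - N)%:R ^+ 2)^-1 <= _).
  by rewrite !big_seq; apply: ler_sum => n; rewrite mem_index_iota => /andP[nN _];
    exact: far.
rewrite -mulr_sumr -[N.+1]add1n big_addn.
under eq_bigr do rewrite addnK.
apply: le_trans (ler_wpM2l _ (@sum_inv_sq_le K 1 (M - N) _)) _.
- by rewrite !mulr_ge0 ?invr_ge0 ?ler0n.
- by lia.
by rewrite divr1 divfK ?pnatr_eq0.
Qed.

End HalfIntegerSide.

(** * Equality of the two evaluations *)

Section Comparison.
Local Open Scope classical_set_scope.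
Variable K : numFieldType.
Hypothesis hnull : harmonic_null K.
Hypothesis hcompl : harmonic_complete K.
Implicit Types (x z w y : K) (f g : K -> K) (p q n m j k l M N t i : nat).

Lemma tn_pred n p z : (0 < n)%N ->
  tn n.-1 p z = tn n p z - z ^+ n / (n%:R - 2^-1) ^+ p.
Proof. by case: n => // n _; rewrite /tn [in RHS]big_nat_recr //= addrK. Qed.

(** The bilateral sum of the kernel in terms of T and ti: the first group comes
    from positive, the second from negative half-integers. *)
Definition kernel_limit x x1 x2 p1 p2 q : K :=
  let w := x * x1 * x2 in
  (x * Tquad p1 p2 q x1 x2 w^-1 - x * ti p1 x1 * Tlin p2 q x2 w^-1
   - x * ti p2 x2 * Tlin p1 q x1 w^-1 + x * ti p1 x1 * ti p2 x2 * ti q w^-1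
   + x * ti p2 x2 * ti (p1 + q) (x * x2)^-1 - x * Tlin p2 (p1 + q) x2 (x * x2)^-1
   + x * ti p1 x1 * ti (p2 + q) (x * x1)^-1 - x * Tlin p1 (p2 + q) x1 (x * x1)^-1
   + x * ti (p1 + p2 + q) x^-1)
  + ((-1) ^+ (p1 + p2 + q) * Tquad p1 p2 q x1^-1 x2^-1 w
   + (-1) ^+ (p2 + q) * x1^-1 * ti p1 x1 * Tlin p2 q x2^-1 w
   + (-1) ^+ (p1 + q) * x2^-1 * ti p2 x2 * Tlin p1 q x1^-1 w
   + (-1) ^+ q * (x1 * x2)^-1 * ti p1 x1 * ti p2 x2 * ti q w).

(** In the first group t_(n-1) is written as t_n - x^n / (n - 1/2)^p, whence the
    series T with one factor t_n and the exponents p1 + q and p2 + q. *)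
Lemma kernel_termE x x1 x2 p1 p2 q n : x != 0 -> x1 != 0 -> x2 != 0 ->
  (0 < n)%N ->
  let w := x * x1 * x2 in let h := n%:R - 2^-1 in
  kernel_term x x1 x2 p1 p2 q n =
  (x * (tn n p1 x1 * tn n p2 x2 / h ^+ q * w^-1 ^+ n)
   - x * ti p1 x1 * (tn n p2 x2 / h ^+ q * w^-1 ^+ n)
   - x * ti p2 x2 * (tn n p1 x1 / h ^+ q * w^-1 ^+ n)
   + x * ti p1 x1 * ti p2 x2 * (w^-1 ^+ n / h ^+ q)
   + x * ti p2 x2 * ((x * x2)^-1 ^+ n / h ^+ (p1 + q))
   - x * (tn n p2 x2 / h ^+ (p1 + q) * (x * x2)^-1 ^+ n)
   + x * ti p1 x1 * ((x * x1)^-1 ^+ n / h ^+ (p2 + q))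
   - x * (tn n p1 x1 / h ^+ (p2 + q) * (x * x1)^-1 ^+ n)
   + x * (x^-1 ^+ n / h ^+ (p1 + p2 + q)))
  + ((-1) ^+ (p1 + p2 + q) * (tn n p1 x1^-1 * tn n p2 x2^-1 / h ^+ q * w ^+ n)
   + (-1) ^+ (p2 + q) * x1^-1 * ti p1 x1 * (tn n p2 x2^-1 / h ^+ q * w ^+ n)
   + (-1) ^+ (p1 + q) * x2^-1 * ti p2 x2 * (tn n p1 x1^-1 / h ^+ q * w ^+ n)
   + (-1) ^+ q * (x1 * x2)^-1 * ti p1 x1 * ti p2 x2 * (w ^+ n / h ^+ q)).
Proof.
move=> x0 x10 x20 n0 w h; rewrite /kernel_term /w; congr (_ + _).
  have h0 : h != 0 by have [_ /gt_eqF ->] := half_lt_shift (half_shift K) n0.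
  rewrite /lerch_pos !tn_pred // -/h !exprVn !exprMn !exprD.
  have := expf_neq0 n x0; have := expf_neq0 n x10; have := expf_neq0 n x20.
  have := expf_neq0 p1 h0; have := expf_neq0 p2 h0; have := expf_neq0 q h0.
  move: (x ^+ n) (x1 ^+ n) (x2 ^+ n) (h ^+ p1) (h ^+ p2) (h ^+ q).
  move: (tn _ _ _) (tn _ _ _) (ti _ _) (ti _ _) => a b c d X X1 X2 H1 H2 H.
  by move=> *; field; do ?[apply/andP; split].
rewrite /lerch_neg -/h [(- h) ^+ q]exprNn invfM -[((-1) ^+ _)^-1]exprVn invrN1.
have e p : (-1) ^+ p * (-1) ^+ p = 1 :> K by rewrite -exprMn mulrNN mulr1 expr1n.
have e1 := e p1; have e2 := e p2.
rewrite !exprD !exprMn invfM.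
move: (tn n p1 x1^-1) (tn n p2 x2^-1) (ti p1 x1) (ti p2 x2) (h ^+ q)^-1 =>
  a b c d H.
move: x1^-1 x2^-1 (x ^+ n) (x1 ^+ n) (x2 ^+ n) ((-1) ^+ q : K) => Y1 Y2 X X1 X2 S.
move: ((-1) ^+ p1 : K) ((-1) ^+ p2 : K) e1 e2 => S1 S2 e1 e2.
transitivity (S * (X * X1 * X2) * H * (S1 * S2 * a * b
  + S2 * (S1 * S1) * Y1 * c * b + S1 * (S2 * S2) * Y2 * d * a + (S1 * S1) *
    (S2 * S2) * Y1 * Y2 * c * d)).
  by ring.
by rewrite e1 e2; ring.
Qed.

Lemma kernel_term_cvg x x1 x2 p1 p2 q :
  `|x| = 1 -> `|x1| = 1 -> `|x2| = 1 ->
  (0 < p1)%N -> (0 < p2)%N -> (0 < q)%N ->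
  (p1, x1) <> (1%N, 1) -> (p2, x2) <> (1%N, 1) ->
  (q, x * x1 * x2) <> (1%N, 1) ->
  (fun N => \sum_(1 <= n < N) kernel_term x x1 x2 p1 p2 q n) @ \oo -->
    kernel_limit x x1 x2 p1 p2 q.
Proof.
move=> nx nx1 nx2 hp1 hp2 hq px1 px2 qx.
have nz z : `|z| = 1 -> z != 0 by move=> z1; rewrite -normr_eq0 z1 oner_eq0.
have nM y z : `|y| = 1 -> `|z| = 1 -> `|y * z| = 1.
  by move=> y1 z1; rewrite normrM y1 z1 mulr1.
have nw : `|x * x1 * x2| = 1 by do 2![apply: (nM) => //].
have nV := @norm_inv1 K; have pV := @pair_neq1V K.
have big2 p p' z : (0 < p)%N -> (0 < p')%N -> ((p + p')%N, z) <> (1%N, 1).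
  by move=> h h' [h'' _]; lia.
have big3 z : ((p1 + p2 + q)%N, z) <> (1%N, 1) by move=> [h'' _]; lia.
have pq p p' : (0 < p)%N -> (0 < p + p')%N by move=> h; rewrite ltn_addr.
pose w := x * x1 * x2.
pose h n : K := n%:R - 2^-1.
pose s (F : nat -> K) N := \sum_(1 <= n < N) F n.
have -> : (fun N => \sum_(1 <= n < N) kernel_term x x1 x2 p1 p2 q n) = fun N =>
  (x * s (fun n => tn n p1 x1 * tn n p2 x2 / h n ^+ q * w^-1 ^+ n) N
   - x * ti p1 x1 * s (fun n => tn n p2 x2 / h n ^+ q * w^-1 ^+ n) N
   - x * ti p2 x2 * s (fun n => tn n p1 x1 / h n ^+ q * w^-1 ^+ n) N
   + x * ti p1 x1 * ti p2 x2 * s (fun n => w^-1 ^+ n / h n ^+ q) N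
   + x * ti p2 x2 * s (fun n => (x * x2)^-1 ^+ n / h n ^+ (p1 + q)) N
   - x * s (fun n => tn n p2 x2 / h n ^+ (p1 + q) * (x * x2)^-1 ^+ n) N
   + x * ti p1 x1 * s (fun n => (x * x1)^-1 ^+ n / h n ^+ (p2 + q)) N
   - x * s (fun n => tn n p1 x1 / h n ^+ (p2 + q) * (x * x1)^-1 ^+ n) N
   + x * s (fun n => x^-1 ^+ n / h n ^+ (p1 + p2 + q)) N)
  + ((-1) ^+ (p1 + p2 + q) * s
    (fun n => tn n p1 x1^-1 * tn n p2 x2^-1 / h n ^+ q * w ^+ n) N
   + (-1) ^+ (p2 + q) * x1^-1 * ti p1 x1 * s
     (fun n => tn n p2 x2^-1 / h n ^+ q * w ^+ n) N
   + (-1) ^+ (p1 + q) * x2^-1 * ti p2 x2 * s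
     (fun n => tn n p1 x1^-1 / h n ^+ q * w ^+ n) N
   + (-1) ^+ q * (x1 * x2)^-1 * ti p1 x1 * ti p2 x2 * s
     (fun n => w ^+ n / h n ^+ q) N).
  apply/funext => N; rewrite /s !mulr_sumr -!sumrB.
  do ![rewrite -!big_split /= | rewrite -!sumrB].
  rewrite !big_seq; apply: eq_bigr => n; rewrite mem_index_iota => /andP[n0 _].
  by apply: kernel_termE => //; exact: nz.
have cM c (F : nat -> K) (l : K) : F @ \oo --> l ->
    (fun N => c * F N) @ \oo --> c * l.
  by move=> Fl; apply: cvgM => //; exact: cvg_cst.
rewrite /kernel_limit -/w /s /h.
have HT := Tlin_cvg hcompl; have Ht := ti_cvg hcompl; have HQ := Tquad_cvg hcompl.
apply: cvgD; last first.
  apply: cvgD; [apply: cvgD; [apply: cvgD|]|]; apply: cM.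
  - by apply: HQ => //; auto.
  - by apply: HT => //; auto.
  - by apply: HT => //; auto.
  - exact: Ht.
apply: cvgD; [apply: cvgB; [apply: cvgD; [apply: cvgB; [apply: cvgD;
  [apply: cvgD; [apply: cvgB; [apply: cvgB|]|]|]|]|]|]|]; apply: cM.
- by apply: HQ => //; auto.
- by apply: HT => //; auto.
- by apply: HT => //; auto.
- by apply: Ht => //; auto.
- by apply: Ht => //; auto.
- by apply: HT => //; auto.
- by apply: Ht => //; auto.
- by apply: HT => //; auto.
- by apply: Ht => //; auto.
Qed.

(** The bilateral sum of the kernel truncated at N equals its sum over poles,
    which tends to [residue_limit], and is within a null sequence of the partial
    sums of [kernel_limit]. *)
Theorem kernel_limit_eq_residue_limit x x1 x2 p1 p2 q :
  `|x| = 1 -> `|x1| = 1 -> `|x2| = 1 ->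
  (0 < p1)%N -> (0 < p2)%N -> (0 < q)%N ->
  (p1, x1) <> (1%N, 1) -> (p2, x2) <> (1%N, 1) ->
  (q, x * x1 * x2) <> (1%N, 1) ->
  kernel_limit x x1 x2 p1 p2 q = residue_limit x x1 x2 p1 p2 q.
Proof.
move=> nx nx1 nx2 hp1 hp2 hq px1 px2 qx.
have hK := kernel_term_cvg nx nx1 nx2 hp1 hp2 hq px1 px2 qx.
have hR := residue_sum_cvg hnull hcompl nx nx1 nx2 hp1 hp2 hq px1 px2 qx.
have [C hC] := bilateral_sum_kernel_bound hcompl nx nx1 nx2 hp1 hp2 hq px1 px2.
have hK1 : (fun N => \sum_(1 <= n < N.+2) kernel_term x x1 x2 p1 p2 q n) @ \oo -->
    kernel_limit x x1 x2 p1 p2 q.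
  by rewrite -(cvg_shiftn 2) /= in hK; under eq_fun do rewrite -addn2.
have e0 : (fun N => C * (harmonic_convolution K N.+1 + N.+1%:R^-1)) @ \oo
    --> C * (0 + 0).
  apply: cvgM; first exact: cvg_cst.
  apply: cvgD; last exact: hnull.
  by rewrite (@cvg_shiftS K (harmonic_convolution K));
    exact: harmonic_convolution_cvg0.
rewrite addr0 mulr0 in e0.
apply: (norm_cvg_unique _ hR); apply: (cvg_eq0 hK1).
apply: cvg0_le e0 => N N0.
apply: (@cvg_lim_le _
  (bilateral_sum x (fun s => lerch_partial N.+1 p1 x1 s
  * lerch_partial N.+1 p2 x2 s / s ^+ q))).
  exact: bilateral_sum_kernel_cvg.
by exists N.+2 => // M /= NM; rewrite distrC; apply: hC.
Qed.

End Comparison.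

(** * The parity formula *)

Section Formula.
Variable K : numFieldType.
Implicit Types (x z y : K) (p q m k t : nat).

Lemma binC p t : (0 < p)%N -> 'C(t + p - 1, p - 1) = 'C(p + t - 1, t).
Proof.
move=> p0; rewrite -bin_sub; last by lia.
by congr 'C(_, _); lia.
Qed.

Lemma principal_part_poleE p (c : nat -> K) x :
  principal_part p c (pole_value x 0) = - \sum_(m < p) c (p - 1 - m)%N
    * ti_factor m x.
Proof.
rewrite /principal_part -sumrN; apply: eq_bigr => m _.
by rewrite /pole_value expr0 mul1r mulrN.
Qed.

Lemma sum_diag P (F : nat -> nat -> K) :
  \sum_(m < P) \sum_(k < P | (m + k == P - 1)%N) F m k
  = \sum_(m < P) F m (P - 1 - m)%N.
Proof.
apply: eq_bigr => m _; have hm := ltn_ord m.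
have kP : (P - 1 - m < P)%N by lia.
rewrite (big_pred1 (Ordinal kP)) // => k /=; rewrite -val_eqE /=.
by apply/eqP/eqP; lia.
Qed.

Lemma sum_le_ord P (m : nat) (F : nat -> K) : (m < P)%N ->
  \sum_(k < P | (m + k <= P - 1)%N) F k = \sum_(k < (P - 1 - m).+1) F k.
Proof.
move=> mP; rewrite (big_ord_widen_cond P predT F); last by lia.
by apply: eq_bigl => k /=; lia.
Qed.

Lemma Li_coef_sum p P z x : (0 < p)%N ->
  \sum_(m < P) \sum_(k < P | (m + k == P - 1)%N)
    (-1) ^+ k * 'C(k + p - 1, p - 1)%:R * Li (k + p) z * ti_factor m x
  = - principal_part P (Li_coef p z) (pole_value x 0).
Proof.
move=> p0; rewrite principal_part_poleE opprK
  (sum_diag P (fun m k => (-1) ^+ k * 'C(k + p - 1, p - 1)%:R * Li (k + p) z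
    * ti_factor m x)).
by apply: eq_bigr => m _; rewrite /Li_coef binC // [(p + _)%N]addnC.
Qed.

Lemma Li_power_sum P q y x : (0 < q)%N ->
  (-1) ^+ q * (\sum_(m < P) 'C(P + q - m - 2, q - 1)%:R * ti_factor m x
                * Li (P + q - m - 1) y)
  = - principal_part P (fun t => (-1) ^+ q * 'C(q + t - 1, t)%:R * Li (q + t) y)
        (pole_value x 0).
Proof.
move=> q0; rewrite principal_part_poleE opprK mulr_sumr; apply: eq_bigr => m _.
have hm := ltn_ord m; rewrite -binC //.
have -> : (P + q - m - 2 = P - 1 - m + q - 1)%N by lia.
have -> : (P + q - m - 1 = q + (P - 1 - m))%N by lia.
by ring.
Qed.

Lemma Li_Li_sum p1 p2 q z1 z2 x : (0 < p1)%N -> (0 < p2)%N ->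
  \sum_(m < q) \sum_(k1 < q) \sum_(k2 < q | (m + k1 + k2 == q - 1)%N)
    (-1) ^+ (k1 + k2) * 'C(k1 + p1 - 1, p1 - 1)%:R * 'C(k2 + p2 - 1, p2 - 1)%:R
    * Li (k1 + p1) z1 * Li (k2 + p2) z2 * ti_factor m x
  = - principal_part q
    (fun t => \sum_(i < t.+1) Li_coef p1 z1 i * Li_coef p2 z2 (t - i))
        (pole_value x 0).
Proof.
move=> h1 h2; rewrite principal_part_poleE opprK; apply: eq_bigr => m _;
  have hm := ltn_ord m.
pose F k1 := Li_coef p1 z1 k1 * Li_coef p2 z2 (q - 1 - m - k1) * ti_factor m x.
transitivity (\sum_(k1 < q | (m + k1 <= q - 1)%N) F k1); last first.
  by rewrite sum_le_ord // mulr_suml.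
rewrite [RHS]big_mkcond; apply: eq_bigr => k1 _; case: ifPn => h; last first.
  by rewrite big_pred0 // => k2; apply/negbTE; lia.
have k2q : (q - 1 - m - k1 < q)%N by lia.
rewrite (big_pred1 (Ordinal k2q)) => [|k2]; last first.
  by move=> /=; rewrite -val_eqE /=; apply/eqP/eqP; lia.
rewrite /F /Li_coef /= !binC // exprD.
rewrite [(p1 + k1)%N]addnC [(p2 + _)%N]addnC; ring.
Qed.

Lemma S_coef_sum p p' q z y x : (0 < p')%N -> (0 < q)%N ->
  (-1) ^+ q * (\sum_(m < p) \sum_(k < p | (m + k <= p - 1)%N)
     'C(k + p' - 1, p' - 1)%:R * 'C(p + q - m - k - 2, q - 1)%:R * ti_factor m x
     * ((-1) ^+ k * Li (k + p') z * Li (p + q - m - k - 1) y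
        + (-1) ^+ p' * Slin (k + p') (p + q - m - k - 1) z^-1 y))
  = - principal_part p (S_coef p' q z y) (pole_value x 0).
Proof.
move=> hp hq; rewrite principal_part_poleE opprK mulr_sumr; apply: eq_bigr => m _.
have hm := ltn_ord m.
rewrite (sum_le_ord
  (fun k => 'C(k + p' - 1, p' - 1)%:R * 'C(p + q - m - k - 2, q - 1)%:R
  * ti_factor m x
     * ((-1) ^+ k * Li (k + p') z * Li (p + q - m - k - 1) y
        + (-1) ^+ p' * Slin (k + p') (p + q - m - k - 1) z^-1 y)) hm).
rewrite /S_coef mulr_suml mulr_sumr; apply: eq_bigr => k _.
have hk := ltn_ord k; rewrite -!binC //.
have -> : (p + q - m - k - 2 = p - 1 - m - k + q - 1)%N by lia.
have -> : (p + q - m - k - 1 = q + (p - 1 - m - k))%N by lia.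
rewrite [(p' + k)%N]addnC; ring.
Qed.

Lemma root_of_unity_norm1 z : is_root_of_unity z -> `|z| = 1.
Proof.
move=> [n n0 /unity_rootP zn]; apply/eqP.
by rewrite -(pexpr_eq1 n0) // -normrX zn normr1.
Qed.

(** The pole of highest order contributes ti(x^-1) as well as ti(x); the former
    cancels the last term of the first group of [kernel_limit]. *)
Lemma top_pole_value x p : (1 < p)%N ->
  pole_value x 0 (p - 1) = (-1) ^+ p * ti p x + x * ti p x^-1.
Proof.
case: p => [//|[//|p]] _; rewrite /pole_value /ti_factor subn1 /=.
by rewrite [in RHS]exprS; ring.
Qed.

(** Rearrangement of [kernel_limit_eq_residue_limit].  The polar parts become
    the binomial sums of the final statement when written out, the Taylor index
    being t = p - 1 - m. *)
Theorem parity_formula x x1 x2 p1 p2 q :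
  harmonic_null K -> harmonic_complete K ->
  `|x| = 1 -> `|x1| = 1 -> `|x2| = 1 ->
  (0 < p1)%N -> (0 < p2)%N -> (0 < q)%N ->
  (p1, x1) <> (1%N, 1) -> (p2, x2) <> (1%N, 1) ->
  (q, x * x1 * x2) <> (1%N, 1) ->
  x * Tquad p1 p2 q x1 x2 (x * x1 * x2)^-1
  + (-1) ^+ (p1 + p2 + q) * Tquad p1 p2 q x1^-1 x2^-1 (x * x1 * x2)
  = x * Tlin p1 (p2 + q) x1 (x * x1)^-1
    + x * Tlin p2 (p1 + q) x2 (x * x2)^-1
    + x * ti p1 x1 * Tlin p2 q x2 (x * x1 * x2)^-1
    + x * ti p2 x2 * Tlin p1 q x1 (x * x1 * x2)^-1
    - (-1) ^+ (p2 + q) * x1^-1 * ti p1 x1 * Tlin p2 q x2^-1 (x * x1 * x2)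
    - (-1) ^+ (p1 + q) * x2^-1 * ti p2 x2 * Tlin p1 q x1^-1 (x * x1 * x2)
    + (-1) ^+ (p1 + p2 + q) * ti (p1 + p2 + q) x
    - x * ti p1 x1 * ti (p2 + q) (x * x1)^-1
    - x * ti p2 x2 * ti (p1 + q) (x * x2)^-1
    - x * ti p1 x1 * ti p2 x2 * ti q (x * x1 * x2)^-1
    - (-1) ^+ q * (x1 * x2)^-1 * ti p1 x1 * ti p2 x2 * ti q (x * x1 * x2)
    + principal_part (p1 + q) (Li_coef p2 x2) (pole_value x 0)
    + principal_part (p2 + q) (Li_coef p1 x1) (pole_value x 0)
    + principal_part (p1 + p2) (fun t => (-1) ^+ q * 'C(q + t - 1, t)%:R
        * Li (q + t) (x * x1 * x2)) (pole_value x 0)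
    + principal_part q
      (fun t => \sum_(i < t.+1) Li_coef p1 x1 i * Li_coef p2 x2 (t - i))
        (pole_value x 0)
    + principal_part p2 (S_coef p1 q x1 (x * x1 * x2)) (pole_value x 0)
    + principal_part p1 (S_coef p2 q x2 (x * x1 * x2)) (pole_value x 0).
Proof.
move=> hnull hcompl nx nx1 nx2 hp1 hp2 hq px1 px2 qx.
have := kernel_limit_eq_residue_limit hnull hcompl nx nx1 nx2 hp1 hp2 hq px1 px2 qx.
rewrite /kernel_limit /residue_limit /= top_pole_value; last by clear -hp1 hp2; lia.
rewrite [x * x2 * x1]mulrAC => /eqP; rewrite -subr_eq0 => /eqP h.
by apply/eqP; rewrite -subr_eq0; apply/eqP; rewrite -[RHS]h; ring.
Qed.

End Formula.

Local Open Scope complex_scope.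

Theorem theorem4p1 (R : realType) (x x1 x2 : R[i]) (p1 p2 q : nat)
  (hx : is_root_of_unity x) (hx1 : is_root_of_unity x1)
  (hx2 : is_root_of_unity x2)
  (hp1 : (1 <= p1)%N) (hp2 : (1 <= p2)%N) (hq : (1 <= q)%N)
  (hp1x1 : (p1, x1) <> (1%N, 1)) (hp2x2 : (p2, x2) <> (1%N, 1))
  (hqx : (q, x * x1 * x2) <> (1%N, 1)) :
  x * Tquad p1 p2 q x1 x2 (x * x1 * x2)^-1
  + (-1) ^+ (p1 + p2 + q) * Tquad p1 p2 q x1^-1 x2^-1 (x * x1 * x2)
  = x * Tlin p1 (p2 + q) x1 (x * x1)^-1
    + x * Tlin p2 (p1 + q) x2 (x * x2)^-1
    + x * ti p1 x1 * Tlin p2 q x2 (x * x1 * x2)^-1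
    + x * ti p2 x2 * Tlin p1 q x1 (x * x1 * x2)^-1
    - (-1) ^+ (p2 + q) * x1^-1 * ti p1 x1 * Tlin p2 q x2^-1 (x * x1 * x2)
    - (-1) ^+ (p1 + q) * x2^-1 * ti p2 x2 * Tlin p1 q x1^-1 (x * x1 * x2)
    + (-1) ^+ (p1 + p2 + q) * ti (p1 + p2 + q) x
    - x * ti p1 x1 * ti (p2 + q) (x * x1)^-1
    - x * ti p2 x2 * ti (p1 + q) (x * x2)^-1
    - x * ti p1 x1 * ti p2 x2 * ti q (x * x1 * x2)^-1
    - (-1) ^+ q * (x1 * x2)^-1 * ti p1 x1 * ti p2 x2 * ti q (x * x1 * x2)
    - (\sum_(m < p1 + q) \sum_(k < p1 + q | (m + k == p1 + q - 1)%N)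
         (-1) ^+ k * 'C(k + p2 - 1, p2 - 1)%:R * Li (k + p2) x2
         * ti_factor m x)
    - (\sum_(m < p2 + q) \sum_(k < p2 + q | (m + k == p2 + q - 1)%N)
         (-1) ^+ k * 'C(k + p1 - 1, p1 - 1)%:R * Li (k + p1) x1
         * ti_factor m x)
    - (-1) ^+ q
      * (\sum_(m < p1 + p2)
           'C(p1 + p2 + q - m - 2, q - 1)%:R * ti_factor m x
           * Li (p1 + p2 + q - m - 1) (x * x1 * x2))
    - (\sum_(m < q) \sum_(k1 < q) \sum_(k2 < q | (m + k1 + k2 == q - 1)%N)
         (-1) ^+ (k1 + k2)
         * 'C(k1 + p1 - 1, p1 - 1)%:R * 'C(k2 + p2 - 1, p2 - 1)%:R
         * Li (k1 + p1) x1 * Li (k2 + p2) x2 * ti_factor m x)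
    - (-1) ^+ q
      * (\sum_(m < p2) \sum_(k < p2 | (m + k <= p2 - 1)%N)
           'C(k + p1 - 1, p1 - 1)%:R * 'C(p2 + q - m - k - 2, q - 1)%:R
           * ti_factor m x
           * ((-1) ^+ k * Li (k + p1) x1
                * Li (p2 + q - m - k - 1) (x * x1 * x2)
              + (-1) ^+ p1
                * Slin (k + p1) (p2 + q - m - k - 1) x1^-1 (x * x1 * x2)))
    - (-1) ^+ q
      * (\sum_(m < p1) \sum_(k < p1 | (m + k <= p1 - 1)%N)
           'C(k + p2 - 1, p2 - 1)%:R * 'C(p1 + q - m - k - 2, q - 1)%:R
           * ti_factor m x
           * ((-1) ^+ k * Li (k + p2) x2
                * Li (p1 + q - m - k - 1) (x * x1 * x2)
              + (-1) ^+ p2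
                * Slin (k + p2) (p1 + q - m - k - 1) x2^-1 (x * x1 * x2))).
Proof.
rewrite !Li_coef_sum // Li_power_sum // Li_Li_sum // !S_coef_sum // !opprK.
apply: parity_formula => //; try exact: root_of_unity_norm1.
- exact: complex_harmonic_null.
- exact: complex_harmonic_complete.
Qed.
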